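(* Let $\mathcal{M}$ be a von Neumann algebra equipped with a normal faithful state $\phi$. Let $\mathbb{E}\colon\mathcal{M}\to\mathcal{M}$ be a state preserving normal conditional expectation. The following properties are equivalent. (1) $\mathbb{E}$ is entanglement breaking. (2) $\mathbb{E}$ is PPT. (3) The range $\mathrm{Ran}\,\mathbb{E}$ is abelian.
   Context: Let $A,B$ be $C^*$-algebras and $T\colon A\to B$ a linear map. $T$ is entanglement breaking if for any $C^*$-algebra $C$ and any positive map $P\colon B\to C$ the map $P\circ T\colon A\to C$ is completely positive. $T$ is PPT if both $T\colon A\to B$ and $T\colon A\to B^{\mathrm{op}}$ are completely positive, where $B^{\mathrm{op}}$ is the opposite algebra. State preserving means $\phi\circ\mathbb{E}=\phi$. *)

(* Defs.v *)
From HB Require Import structures.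
From mathcomp Require Import all_boot all_order all_algebra.
From mathcomp Require Import complex sesquilinear.
From mathcomp Require Import all_classical all_reals all_analysis.

Set Implicit Arguments.
Unset Strict Implicit.
Unset Printing Implicit Defensive.

Import Order.TTheory GRing.Theory Num.Theory.
Import numFieldNormedType.Exports.

Local Open Scope classical_set_scope.
Local Open Scope ring_scope.
Local Open Scope complex_scope.

(* C*-algebras are not assumed unital. The norm takes values in R[i], where
   x <= y means that y - x is a nonnegative real. *)
HB.mixin Record isCStarAlgebra (R : realType) (A : Type)
    of CompleteNormedModule R[i] A := {
  cmul : A -> A -> A ;
  cstar : A -> A ;
  cmulA : associative cmul ;
  cmulDl : left_distributive cmul +%R ;
  cmulDr : right_distributive cmul +%R ;
  cmulZl : forall (k : R[i]) (a b : A), cmul (k *: a) b = k *: cmul a b ;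
  cmulZr : forall (k : R[i]) (a b : A), cmul a (k *: b) = k *: cmul a b ;
  cstarK : involutive cstar ;
  cstarD : {morph cstar : a b / a + b} ;
  cstarZ : forall (k : R[i]) (a : A), cstar (k *: a) = Num.conj k *: cstar a ;
  cstarM : forall a b : A, cstar (cmul a b) = cmul (cstar b) (cstar a) ;
  norm_cmul_le : forall a b : A, `|cmul a b| <= `|a| * `|b| ;
  norm_cstar_cmul : forall a : A, `|cmul (cstar a) a| = `|a| ^+ 2
}.

#[short(type="cstarAlgType")]
HB.structure Definition CStarAlgebra (R : realType) :=
  {A of CompleteNormedModule R[i] A & isCStarAlgebra R A}.

Definition opposite (T : Type) : Type := T.

Section Opposite.
Variables (R : realType) (A : cstarAlgType R).

HB.instance Definition _ := CompleteNormedModule.on (opposite A).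

Let opmul (a b : opposite A) : opposite A := cmul (b : A) (a : A).
Let opstar (a : opposite A) : opposite A := cstar (a : A).

Let opmulA : associative opmul.
Proof. by move=> a b c; rewrite /opmul cmulA. Qed.

Let opmulDl : left_distributive opmul +%R.
Proof. by move=> a b c; exact: cmulDr. Qed.

Let opmulDr : right_distributive opmul +%R.
Proof. by move=> a b c; exact: cmulDl. Qed.

Let opmulZl (k : R[i]) (a b : opposite A) :
  opmul (k *: a) b = k *: opmul a b.
Proof. exact: cmulZr. Qed.

Let opmulZr (k : R[i]) (a b : opposite A) :
  opmul a (k *: b) = k *: opmul a b.
Proof. exact: cmulZl. Qed.

Let opstarK : involutive opstar.
Proof. exact: cstarK. Qed.

Let opstarD : {morph opstar : a b / a + b}.
Proof. exact: cstarD. Qed.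

Let opstarZ (k : R[i]) (a : opposite A) :
  opstar (k *: a) = Num.conj k *: opstar a.
Proof. exact: cstarZ. Qed.

Let opstarM (a b : opposite A) :
  opstar (opmul a b) = opmul (opstar b) (opstar a).
Proof. exact: cstarM. Qed.

Let norm_opmul_le (a b : opposite A) : `|opmul a b| <= `|a| * `|b|.
Proof. by rewrite mulrC; exact: norm_cmul_le. Qed.

Let norm_opstar_opmul (a : opposite A) : `|opmul (opstar a) a| = `|a| ^+ 2.
Proof.
have norm_starV (b : A) : `|b| <= `|cstar b|.
  have [->|b0] := eqVneq b 0; first by rewrite normr0.
  have b_gt0 : 0 < `|b| by rewrite normr_gt0.
  by rewrite -(ler_pM2r b_gt0) -expr2 -norm_cstar_cmul norm_cmul_le.
have norm_star (b : A) : `|cstar b| = `|b|.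
  apply/eqP; rewrite eq_le norm_starV andbT.
  by rewrite -[leRHS](congr1 Num.norm (cstarK b)) norm_starV.
have := norm_cstar_cmul (cstar (a : A)); rewrite cstarK norm_star.
exact.
Qed.

HB.instance Definition _ := isCStarAlgebra.Build R (opposite A)
  opmulA opmulDl opmulDr opmulZl opmulZr opstarK opstarD opstarZ opstarM
  norm_opmul_le norm_opstar_opmul.

End Opposite.

Section Positivity.
Variable R : realType.
Implicit Types A B : cstarAlgType R.

Definition cpos A (a : A) : Prop := exists b : A, a = cmul (cstar b) b.

Definition cle A (a b : A) : Prop := cpos (b - a).

Definition mxcmul A n (X Y : 'M[A]_n) : 'M[A]_n :=
  \matrix_(i, j) \sum_k cmul (X i k) (Y k j).

Definition mxcstar A n (X : 'M[A]_n) : 'M[A]_n :=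
  \matrix_(i, j) cstar (X j i).

(* Positivity in the C*-algebra M_n(A). *)
Definition mxcpos A n (X : 'M[A]_n) : Prop :=
  exists Y : 'M[A]_n, X = mxcmul (mxcstar Y) Y.

(* The notions below only concern linear maps. They take the underlying
   function, so that a map into B can also be read as a map into opposite B,
   which is the same vector space. *)
Definition positive_map A B (T : A -> B) : Prop :=
  forall a, cpos a -> cpos (T a).

Definition completely_positive A B (T : A -> B) : Prop :=
  forall n (X : 'M[A]_n), mxcpos X -> mxcpos (map_mx T X).

Definition entanglement_breaking A B (T : A -> B) : Prop :=
  forall (C : cstarAlgType R) (P : {linear B -> C}),
    positive_map P -> completely_positive (P \o T).

Definition ppt A B (T : A -> B) : Prop :=
  completely_positive T /\ completely_positive (T : A -> opposite B).

Definition is_lub (T : Type) (le : T -> T -> Prop) (D : set T) (s : T) : Prop :=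
  (forall d, D d -> le d s) /\ (forall u, (forall d, D d -> le d u) -> le s u).

(* Normality: preservation of suprema of bounded increasing nets of
   self-adjoint elements; leV is the order of the codomain. *)
Definition normal_map A (V : Type) (leV : V -> V -> Prop) (T : A -> V) : Prop :=
  forall (D : set A) (s : A),
    D !=set0 ->
    (forall d, D d -> cstar d = d) ->
    (forall a b, D a -> D b -> exists2 c, D c & cle a c /\ cle b c) ->
    is_lub (@cle A) D s ->
    is_lub leV (T @` D) (T s).

End Positivity.

(* Inner products are linear in the first variable. *)
HB.mixin Record isHilbert (R : realType) (H : Type)
    of CompleteNormedModule R[i] H := {
  hdot : {dot H for @Num.conj R[i]} ;
  norm_hdot : forall x : H, `|x| ^+ 2 = hdot x x
}.

#[short(type="hilbertType")]
HB.structure Definition Hilbert (R : realType) :=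
  {H of CompleteNormedModule R[i] H & isHilbert R H}.

Section Operators.
Variables (R : realType) (H : hilbertType R).
Implicit Types (S : set (H -> H)) (T U : H -> H).

Definition bounded_operator T : Prop :=
  linear T /\ exists c : R[i], forall x, `|T x| <= c * `|x|.

Definition adjoint T U : Prop := forall x y, hdot (T x) y = hdot x (U y).

Definition commutant S : set (H -> H) :=
  [set T | bounded_operator T /\ forall U, S U -> T \o U = U \o T].

(* A self-adjoint set of bounded operators equal to its bicommutant; such a
   set is automatically a unital subalgebra of B(H). *)
Definition is_vonNeumann S : Prop :=
  [/\ forall T, S T -> bounded_operator T,
      forall T, S T -> exists2 U, S U & adjoint T U
    & S = commutant (commutant S)].

End Operators.

(* A von Neumann algebra on a Hilbert space, given as a C*-algebra together
   with its isometric inclusion in B(H): norms are operator norms. *)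
Record vonNeumannAlgebra (R : realType) := VonNeumannAlgebra {
  vn_sort :> cstarAlgType R ;
  vn_space : hilbertType R ;
  vn_act : vn_sort -> vn_space -> vn_space ;
  vn_one : vn_sort ;
  vn_act_linear : forall x, linear (vn_act ^~ x) ;
  vn_actM : forall a b, vn_act (cmul a b) = vn_act a \o vn_act b ;
  vn_act_star : forall a, adjoint (vn_act a) (vn_act (cstar a)) ;
  vn_act1 : vn_act vn_one = id ;
  vn_norm_ub : forall a x, `|vn_act a x| <= `|a| * `|x| ;
  vn_norm_lub : forall a (c : R[i]), 0 <= c ->
    (forall x, `|vn_act a x| <= c * `|x|) -> `|a| <= c ;
  vn_range : is_vonNeumann (range vn_act)
}.

Section VonNeumann.
Variables (R : realType) (M : vonNeumannAlgebra R).

Definition is_vn_subalgebra (N : set M) : Prop :=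
  is_vonNeumann (@vn_act R M @` N).

Definition normal_faithful_state (phi : {scalar M}) : Prop :=
  [/\ forall a : M, cpos a -> 0 <= phi a,
      phi (vn_one M) = 1,
      normal_map (fun x y : R[i] => x <= y) phi
    & forall a : M, cpos a -> phi a = 0 -> a = 0].

Definition normal_conditional_expectation (E : {linear M -> M}) : Prop :=
  [/\ is_vn_subalgebra (range E),
      positive_map E /\ E (vn_one M) = vn_one M,
      forall x, E (E x) = E x,
      forall a x b, range E a -> range E b ->
        E (cmul (cmul a x) b) = cmul (cmul a (E x)) b
    & normal_map (@cle R M) E].

Definition state_preserving (phi : {scalar M}) (E : {linear M -> M}) : Prop :=
  phi \o E = phi.

Definition abelian_subset (N : set M) : Prop :=
  forall x y, N x -> N y -> cmul x y = cmul y x.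

End VonNeumann.

(* Main.v *)
Require Import Defs.
From HB Require Import structures.
From mathcomp Require Import all_boot all_order all_algebra.
From mathcomp Require Import complex sesquilinear.
From mathcomp Require Import all_classical all_reals all_analysis.
From mathcomp Require Import ring lra.
From Stdlib Require Ncring Ncring_tac.

(* (1) => (2): apply the definition to the identity maps into [M] and into its
   opposite; the latter is positive since a positive element has a self-adjoint
   square root.
   (2) => (3): complete positivity into the opposite algebra of the matrix
   [[1, a], [a^*, a^* a]] over the range of [E] gives [a a^* <= a^* a], so every
   element of the range is normal, and polarization gives commutativity.
   (3) => (1): the matrix [E X] of a positive [X] has a square root with entries
   in the range [N] of [E], which reduces the claim to the positivity of
   [P (a_i^* a_j)] for [a_1, ..., a_n] in the abelian algebra [N]. Write
   [a_j = \sum_l c_l(j) f_l] for a partition of unity [f] in [N]. If [w] is a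
   random word of length [K] whose letters are independent with law [f], then the
   second moments of [\sum_m c_(w_m)] are [K (K - 1) a_i^* a_j + K q_ij], where
   [q] does not depend on [K]. They are sent by [P] to a positive matrix, being a
   combination of positive scalar matrices with positive coefficients. Divide by
   [K (K - 1)] and let [K] tend to infinity.
   Positive elements of an abstract C*-algebra [C] and of [M_n(C)] are handled
   without spectra, through the norm-convergent iteration [y' = (x + y^2) / 2] for
   [1 - sqrt (1 - x)]. *)

Set Implicit Arguments.
Unset Strict Implicit.
Unset Printing Implicit Defensive.

Import Order.TTheory GRing.Theory Num.Theory.
Import numFieldNormedType.Exports.

Local Open Scope classical_set_scope.
Local Open Scope complex_scope.
Local Open Scope ring_scope.

(** * Automatic proofs of noncommutative ring identities *)

Section NoncommutativeRingTactic.
Variable A : pzRingType.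
#[global] Instance pzring_ops :
  @Ncring.Ring_ops A 0 1 +%R *%R (fun x y => x - y) -%R (@eq A) := {}.
#[global] Instance pzring_Ncring : Ncring.Ring (Ro := pzring_ops).
Proof.
split.
- exact: RelationClasses.eq_equivalence.
- by move=> ? ? -> ? ? ->.
- by move=> ? ? -> ? ? ->.
- by move=> ? ? -> ? ? ->.
- by move=> ? ? ->.
- exact: add0r.
- exact: addrC.
- exact: addrA.
- exact: mul1r.
- exact: mulr1.
- exact: mulrA.
- exact: mulrDl.
- move=> x y z; exact: mulrDr.
- by [].
- exact: subrr.
Qed.
End NoncommutativeRingTactic.
Ltac ncring := Ncring_tac.non_commutative_ring.

(** * The modulus of complex numbers as a real number *)

Section RealModulus.
Variable R : realType.
Implicit Types k l : R[i].

(** The norm of [R[i]] is itself valued in [R[i]]; its real part lets order, limits and linear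
    arithmetic take place in [R]. *)
Definition cabs k : R := complex.Re `|k|.

Lemma cabsE k : (cabs k)%:C = `|k|.
Proof. by rewrite /cabs RRe_real // normr_real. Qed.

Lemma cabs_ge0 k : 0 <= cabs k.
Proof. by rewrite -ler0c cabsE. Qed.

Lemma cabsM k l : cabs (k * l) = cabs k * cabs l.
Proof. by apply: complexI; rewrite rmorphM /= !cabsE normrM. Qed.

Lemma cabsD k l : cabs (k + l) <= cabs k + cabs l.
Proof. by rewrite -lecR rmorphD /= !cabsE ler_normD. Qed.

Lemma cabs_conj k : cabs (Num.conj k) = cabs k.
Proof. by apply: complexI; rewrite !cabsE norm_conjC. Qed.

Lemma cabs_real (t : R) : 0 <= t -> cabs t%:C = t.
Proof. by move=> t0; apply: complexI; rewrite cabsE ger0_norm // ler0c. Qed.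

Lemma cabsN k : cabs (- k) = cabs k.
Proof. by rewrite /cabs normrN. Qed.

Lemma cabs0 : cabs 0 = 0.
Proof. exact: (cabs_real (lexx 0)). Qed.

Lemma cabs1 : cabs 1 = 1.
Proof. exact: (cabs_real ler01). Qed.

Lemma cabsi : cabs 'i%R = 1.
Proof. by apply: complexI; rewrite cabsE normCi. Qed.

Lemma cabs_eq0 k : cabs k = 0 -> k = 0.
Proof. by move=> k0; apply/normr0_eq0; rewrite -cabsE k0. Qed.

End RealModulus.

(** * Unital C*-algebras with a real-valued norm *)

(* The scalars enter through a central ring morphism rather than a module
   structure, since square matrices over the algebra already carry a module
   structure over it. *)
HB.mixin Record isUnitalCStar (R : realType) (A : Type) of GRing.PzRing A := {
  scal : R[i] -> A ;
  star : A -> A ;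
  nrm : A -> R ;
  scalD : {morph scal : k l / k + l} ;
  scalM : {morph scal : k l / k * l} ;
  scal1 : scal 1 = 1 ;
  scalC : forall k x, scal k * x = x * scal k ;
  starK : involutive star ;
  starD : {morph star : x y / x + y} ;
  starM : forall x y, star (x * y) = star y * star x ;
  star_scal : forall k, star (scal k) = scal (Num.conj k) ;
  nrm_ge0 : forall x, 0 <= nrm x ;
  nrm_eq0 : forall x, nrm x = 0 -> x = 0 ;
  nrmD : forall x y, nrm (x + y) <= nrm x + nrm y ;
  nrmM : forall x y, nrm (x * y) <= nrm x * nrm y ;
  nrm_scal : forall k x, nrm (scal k * x) <= cabs k * nrm x ;
  nrm_sqr_le : forall x, nrm x ^+ 2 <= nrm (star x * x) ;
  nrm_complete : forall u : nat -> A,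
    (forall e : R, 0 < e -> exists N, forall m n, (N <= m)%N -> (N <= n)%N ->
       nrm (u m - u n) < e) ->
    exists l, (fun n => nrm (u n - l)) @ \oo --> (0 : R)
}.

#[short(type="ucstarType")]
HB.structure Definition UnitalCStar (R : realType) :=
  {A of isUnitalCStar R A & GRing.PzRing A}.

(** * Scalars, star, norm and limits *)

Section Basics.
Variables (R : realType) (A : ucstarType R).
Implicit Types (x y a l : A) (t s : R) (k : R[i]).

Definition rs t : A := scal t%:C.
Definition im : A := scal 'i%R.

Lemma scal0 : scal 0 = 0 :> A.
Proof. by apply: (addIr (scal 0)); rewrite -scalD !add0r. Qed.

Lemma scalN k : scal (- k) = - scal k :> A.
Proof. by apply: (addIr (scal k)); rewrite -scalD !addNr scal0. Qed.

Lemma rsM t s : rs (t * s) = rs t * rs s.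
Proof. by rewrite /rs rmorphM /= scalM. Qed.
Lemma rsD t s : rs (t + s) = rs t + rs s.
Proof. by rewrite /rs rmorphD /= scalD. Qed.
Lemma rsN t : rs (- t) = - rs t.
Proof. by rewrite /rs rmorphN /= scalN. Qed.
Lemma rs1 : rs 1 = 1.
Proof. by rewrite /rs rmorph1 scal1. Qed.
Lemma rs0 : rs 0 = 0.
Proof. by rewrite /rs rmorph0 scal0. Qed.
Lemma rsC t x : rs t * x = x * rs t.
Proof. exact: scalC. Qed.
Lemma rs_nat n : rs n%:R = n%:R.
Proof. by elim: n => [|n IH]; rewrite ?rs0 // -!natr1 rsD IH rs1. Qed.
Lemma rsK t x : t != 0 -> rs t^-1 * (rs t * x) = x.
Proof. by move=> t0; rewrite mulrA -rsM mulVf // rs1 mul1r. Qed.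
Lemma rsVK t x : t != 0 -> rs t * (rs t^-1 * x) = x.
Proof. by move=> t0; rewrite mulrA -rsM mulfV // rs1 mul1r. Qed.
Lemma imC x : im * x = x * im.
Proof. exact: scalC. Qed.
Lemma imM : im * im = -1.
Proof. by rewrite /im -scalM -expr2 sqrCi scalN scal1. Qed.

Lemma star0 : star 0 = 0 :> A.
Proof. by apply: (addIr (star 0)); rewrite -starD !add0r. Qed.
Lemma starN x : star (- x) = - star x.
Proof. by apply: (addIr (star x)); rewrite -starD !addNr star0. Qed.
Lemma starB x y : star (x - y) = star x - star y.
Proof. by rewrite starD starN. Qed.
Lemma star_rs t : star (rs t) = rs t.
Proof. by rewrite /rs star_scal conj_Creal // complex_real. Qed.
Lemma star_im : star im = - im.
Proof. by rewrite /im star_scal conjCi scalN. Qed.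
Lemma star1 : star 1 = 1 :> A.
Proof. by rewrite -rs1 star_rs. Qed.
Lemma star_sum (I : Type) (r : seq I) (P : pred I) (F : I -> A) :
  star (\sum_(i <- r | P i) F i) = \sum_(i <- r | P i) star (F i).
Proof. exact: (big_morph _ starD star0). Qed.

Lemma nrm0 : nrm (0 : A) = 0.
Proof.
apply/eqP; rewrite eq_le nrm_ge0 andbT.
by have := nrm_scal 0 (0 : A); rewrite mulr0 cabs0 mul0r.
Qed.
Lemma nrmN x : nrm (- x) = nrm x.
Proof.
have h y : nrm (- y) <= nrm y.
  by have := nrm_scal (-1) y; rewrite scalN scal1 mulN1r cabsN cabs1 mul1r.
by apply/eqP; rewrite eq_le h -{1}[x]opprK h.
Qed.
Lemma nrmB x y : nrm (x - y) <= nrm x + nrm y.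
Proof. by rewrite -[nrm y]nrmN nrmD. Qed.
Lemma nrmBC x y : nrm (x - y) = nrm (y - x).
Proof. by rewrite -nrmN opprB. Qed.

(** Cancel [nrm y] in [nrm y ^+ 2 <= nrm (star y * y) <= nrm (star y) * nrm y]. *)
Lemma nrm_star x : nrm (star x) = nrm x.
Proof.
have h y : nrm y <= nrm (star y).
  have [y0|y0] := eqVneq (nrm y) 0; first by rewrite y0 nrm_ge0.
  have y_gt0 : 0 < nrm y by rewrite lt_def y0 nrm_ge0.
  by rewrite -(ler_pM2r y_gt0) -expr2 (le_trans (nrm_sqr_le y)) // nrmM.
by apply/eqP; rewrite eq_le h -{2}[x]starK h.
Qed.

Lemma nrm_starM x : nrm (star x * x) = nrm x ^+ 2.
Proof.
apply/eqP; rewrite eq_le nrm_sqr_le andbT.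
by rewrite (le_trans (nrmM _ _)) // nrm_star expr2.
Qed.

Lemma nrm_sqr x : star x = x -> nrm (x * x) = nrm x ^+ 2.
Proof. by move=> sx; rewrite -nrm_starM sx. Qed.

(** [nrm 1] equals its own square. Only an inequality holds in general, since in the zero ring
    [nrm 1 = 0]. *)
Lemma nrm1_le : nrm (1 : A) <= 1.
Proof.
have := nrm_sqr star1; rewrite mulr1 => h.
have [->|n0] := eqVneq (nrm (1 : A)) 0; first exact: ler01.
suff -> : nrm (1 : A) = 1 by [].
by apply: (mulfI n0); rewrite -expr2 -h mulr1.
Qed.

Lemma nrm_rs t x : 0 <= t -> nrm (rs t * x) = t * nrm x.
Proof.
move=> t0; apply/eqP; rewrite eq_le; apply/andP; split.
  by have := nrm_scal t%:C x; rewrite cabs_real.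
have [->|tn0] := eqVneq t 0; first by rewrite mul0r nrm_ge0.
have tp : 0 < t by rewrite lt_def tn0.
have := nrm_scal t^-1%:C (rs t * x); rewrite cabs_real ?invr_ge0 //.
by rewrite [X in nrm X]rsK // ler_pdivlMl.
Qed.

Lemma nrm_rs1 t : 0 <= t -> nrm (rs t) <= t.
Proof.
move=> t0; rewrite -[rs t]mulr1 nrm_rs //.
by rewrite ler_piMr // nrm1_le.
Qed.

Lemma nrm_im x : nrm (im * x) <= nrm x.
Proof. by have := nrm_scal 'i%R x; rewrite cabsi mul1r. Qed.

Lemma starM_eq0 x : star x * x = 0 -> x = 0.
Proof.
move=> h; apply: nrm_eq0; apply/eqP.
by rewrite -sqrf_eq0 -nrm_starM h nrm0.
Qed.

Lemma sqr_eq0 x : star x = x -> x * x = 0 -> x = 0.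
Proof. by move=> sx h; apply: starM_eq0; rewrite sx. Qed.

(** * Convergence *)

(** [A] carries no topology, so convergence is stated through the real sequence of distances. *)
Definition tends (u : nat -> A) (l : A) : Prop :=
  (fun n => nrm (u n - l)) @ \oo --> (0 : R).

Lemma tends_le (u : nat -> A) l (v : nat -> R) :
  (forall n, nrm (u n - l) <= v n) -> v @ \oo --> (0 : R) -> tends u l.
Proof.
move=> uv v0; apply: (squeeze_cvgr _ (cvg_cst (0:R)) v0).
by apply: nearW => n; rewrite nrm_ge0 uv.
Qed.

Lemma tends_cst l : tends (fun=> l) l.
Proof.
apply: (@tends_le _ _ (fun=> 0)) => [n|].
  by rewrite subrr nrm0.
exact: cvg_cst.
Qed.

Lemma tends_shift (u : nat -> A) l : tends u l -> tends (fun n => u n.+1) l.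
Proof. by move=> ul; rewrite /tends (cvg_shiftS (fun n => nrm (u n - l))). Qed.

Lemma tends_uniq (u : nat -> A) l m : tends u l -> tends u m -> l = m.
Proof.
move=> ul um; apply/eqP; rewrite -subr_eq0; apply/eqP/nrm_eq0.
apply: (@cvg_unique R _ ((fun=> nrm (l - m)) @ \oo)) => //; first exact: cvg_cst.
apply: (squeeze_cvgr _ (cvg_cst (0:R)) _).
  2: { have := cvgD ul um; rewrite addr0; exact. }
apply: nearW => n; rewrite nrm_ge0 /=.
have -> : l - m = (u n - m) - (u n - l).
  by rewrite opprB [RHS]addrC subrKA.
by rewrite (le_trans (nrmB _ _)) // addrC.
Qed.

Lemma tendsD (u v : nat -> A) l m :
  tends u l -> tends v m -> tends (fun n => u n + v n) (l + m).
Proof.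
move=> ul vm; apply: tends_le => [n|].
  2: { have := cvgD ul vm; rewrite addr0; exact. }
by rewrite /= opprD addrACA nrmD.
Qed.

Lemma tends_map (f : A -> A) (c : R) (u : nat -> A) l :
  (forall x y, nrm (f x - f y) <= c * nrm (x - y)) ->
  tends u l -> tends (fun n => f (u n)) (f l).
Proof.
move=> fc ul; apply: tends_le => [n|]; first exact: fc.
by have := cvgM (cvg_cst c) ul; rewrite mulr0; exact.
Qed.

Lemma tendsMl a (u : nat -> A) l : tends u l -> tends (fun n => a * u n) (a * l).
Proof. by apply: (@tends_map ( *%R a) (nrm a)) => x y; rewrite -mulrBr nrmM. Qed.

Lemma tendsMr a (u : nat -> A) l : tends u l -> tends (fun n => u n * a) (l * a).
Proof.
by apply: (@tends_map ( *%R^~ a) (nrm a)) => x y; rewrite -mulrBl mulrC nrmM.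
Qed.

Lemma tendsN (u : nat -> A) l : tends u l -> tends (fun n => - u n) (- l).
Proof.
by apply: (@tends_map -%R 1) => x y; rewrite -opprD nrmN mul1r.
Qed.

Lemma tends_star (u : nat -> A) l :
  tends u l -> tends (fun n => star (u n)) (star l).
Proof. by apply: (@tends_map star 1) => x y; rewrite -starB nrm_star mul1r. Qed.

Lemma tends_sqr (u : nat -> A) l : tends u l -> tends (fun n => u n * u n) (l * l).
Proof.
move=> ul; pose d n := nrm (u n - l).
apply: (@tends_le _ _ (fun n => d n * d n + nrm l *+ 2 * d n)) => [n|]; last first.
  have := cvgD (cvgM ul ul) (cvgM (cvg_cst (nrm l *+ 2)) ul).
  by rewrite !mulr0 addr0; exact.
have -> : u n * u n - l * l = (u n - l) * (u n - l) + ((u n - l) * l + l * (u n - l)).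
  by rewrite -{1 2}[u n](subrK l) mulrDl !mulrDr !addrA addrK.
apply: (le_trans (nrmD _ _)); apply: lerD; first exact: nrmM.
apply: (le_trans (nrmD _ _)); rewrite mulr2n [leRHS]mulrDl; apply: lerD.
  by rewrite mulrC nrmM.
exact: nrmM.
Qed.

Lemma tends_nrm_le (u : nat -> A) l (c : R) :
  tends u l -> (forall n, nrm (u n) <= c) -> nrm l <= c.
Proof.
move=> ul uc; rewrite -subr_ge0.
have h : (fun n => nrm (u n - l) + (c - nrm l)) @ \oo --> 0 + (c - nrm l).
  by apply: cvgD => //; exact: cvg_cst.
rewrite add0r in h.
apply: (cvgr_to_ge h).
apply: nearW => n; rewrite addrA subr_ge0 addrC.
rewrite -lerBlDr (le_trans _ (uc n)) // lerBlDr -nrmBC.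
by rewrite (le_trans _ (nrmD _ _)) // addrC subrK.
Qed.

End Basics.
Arguments rs {R A} t.
Arguments im {R A}.

(** * Square roots by iteration *)

Section SquareRoot.
Variables (R : realType) (A : ucstarType R).
Implicit Types (x y z a h : A).

(** A fixed point [y = (x + y * y) / 2] satisfies [(1 - y) * (1 - y) = 1 - x]. *)
Fixpoint sqit x n : A :=
  if n is m.+1 then rs 2^-1 * (x + sqit x m * sqit x m) else 0.

(** Increasing and bounded by 1, hence convergent, this sequence controls the increments of [sqit]
    on the unit ball. *)
Fixpoint rit n : R := if n is m.+1 then 2^-1 * (1 + rit m * rit m) else 0.

Lemma rit_ge0 n : 0 <= rit n.
Proof.
elim: n => [//|n IH] /=.
by rewrite mulr_ge0 ?invr_ge0 // addr_ge0 // mulr_ge0.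
Qed.

Lemma rit_le1 n : rit n <= 1.
Proof. by elim: n => [|n IH] /=; rewrite ?ler01 //; have := rit_ge0 n; nra. Qed.

Lemma rit_ndecr : nondecreasing_seq rit.
Proof.
apply/nondecreasing_seqP => n.
by have := rit_le1 n; rewrite /=; nra.
Qed.

Lemma sqit_le x n : nrm x <= 1 -> nrm (sqit x n) <= rit n.
Proof.
move=> x1; elim: n => [|n IH] /=; first by rewrite nrm0.
rewrite nrm_rs ?invr_ge0 // ler_wpM2l ?invr_ge0 //.
rewrite (le_trans (nrmD _ _)) // lerD // (le_trans (nrmM _ _)) //.
by rewrite ler_pM ?nrm_ge0.
Qed.

(* Comparison with the scalar iteration, which is the case [x = 1]. *)
Lemma sqit_step x n : nrm x <= 1 ->
  nrm (sqit x n.+1 - sqit x n) <= rit n.+1 - rit n.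
Proof.
move=> x1; elim: n => [|n IH].
  rewrite /= !subr0 !mulr0 !addr0 nrm_rs ?invr_ge0 //.
  by rewrite ler_wpM2l ?invr_ge0.
pose d := sqit x n.+1 - sqit x n.
have -> : sqit x n.+2 - sqit x n.+1 =
    rs 2^-1 * (sqit x n.+1 * d + d * sqit x n).
  rewrite -[sqit x n.+2]/(rs 2^-1 * (x + sqit x n.+1 * sqit x n.+1)).
  rewrite [X in _ - X]/= -mulrBr opprD addrACA subrr add0r; congr (_ * _).
  by rewrite /d mulrBr mulrBl addrA subrK.
rewrite nrm_rs ?invr_ge0 //.
have -> : rit n.+2 - rit n.+1 =
    2^-1 * (rit n.+1 * (rit n.+1 - rit n) + (rit n.+1 - rit n) * rit n).
  by rewrite /=; field.
rewrite ler_wpM2l ?invr_ge0 // (le_trans (nrmD _ _)) // lerD //.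
  by rewrite (le_trans (nrmM _ _)) // ler_pM ?nrm_ge0 ?sqit_le.
by rewrite (le_trans (nrmM _ _)) // ler_pM ?nrm_ge0 ?sqit_le.
Qed.

Lemma sqit_dist x m n : nrm x <= 1 -> (n <= m)%N ->
  nrm (sqit x m - sqit x n) <= rit m - rit n.
Proof.
move=> x1; elim: m => [|m IH].
  by rewrite leqn0 => /eqP ->; rewrite !subrr nrm0.
rewrite leq_eqVlt => /orP[/eqP ->|]; first by rewrite !subrr nrm0.
rewrite ltnS => /IH {}IH.
rewrite -[sqit x m.+1](subrK (sqit x m)) -addrA (le_trans (nrmD _ _)) //.
by rewrite -[rit m.+1](subrK (rit m)) -addrA lerD // sqit_step.
Qed.

(** A chosen limit; 0 is a mere default for divergent sequences. *)
Definition slim (u : nat -> A) : A := xget 0 [set l | tends u l].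

Lemma sqit_cvg x : nrm x <= 1 -> tends (sqit x) (slim (sqit x)).
Proof.
move=> x1; apply: (@xgetPex A 0 [set l | tends (sqit x) l]).
apply: nrm_complete => e e0.
have /cvg_ex[l rl] : cvgn rit.
  apply: nondecreasing_is_cvgn; first exact: rit_ndecr.
  by exists 1 => _ [n _ <-]; exact: rit_le1.
have rlel n : rit n <= l.
  by rewrite -(cvg_lim _ rl) //; apply: nondecreasing_cvgn_le => //;
     [exact: rit_ndecr | apply/cvg_ex; exists l].
have [N _ hN] := cvgr_dist_lt _ _ rl _ e0.
exists N.
suff h m n : (N <= n)%N -> (n <= m)%N -> nrm (sqit x m - sqit x n) < e.
  move=> m n Nm Nn; have [mn|/ltnW nm] := leqP m n; last exact: h.
  by rewrite nrmBC; exact: h.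
move=> Nn nm; apply: (le_lt_trans (sqit_dist x1 nm)).
apply: le_lt_trans (hN n Nn); rewrite ger0_norm ?subr_ge0 //.
by rewrite lerB.
Qed.

(** Meaningful for [nrm (1 - h) <= 1], where the iteration with [x = 1 - h] converges. *)
Definition csqrt h : A := 1 - slim (sqit (1 - h)).

Section Properties.
Variable h : A.
Hypothesis h1 : nrm (1 - h) <= 1.

Let u := sqit (1 - h).
Let ul : tends u (slim u). Proof. exact: sqit_cvg. Qed.

Lemma csqrt_le : nrm (1 - csqrt h) <= 1.
Proof.
rewrite /csqrt opprB addrCA subrr addr0; apply: (tends_nrm_le ul) => n.
by rewrite (le_trans (sqit_le _ h1)) // rit_le1.
Qed.

Lemma csqrtM : csqrt h * csqrt h = h.
Proof.
have hl : slim u = rs 2^-1 * ((1 - h) + slim u * slim u).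
  apply: (tends_uniq (tends_shift ul)).
  apply: tendsMl; apply: tendsD; first exact: tends_cst.
  exact: tends_sqr.
have {hl} : slim u + slim u = (1 - h) + slim u * slim u.
  have e : 1 = rs 2^-1 + rs 2^-1 :> A.
    by rewrite -rsD -rs1; congr (rs _); field.
  by rewrite -[RHS]mul1r [X in X * _]e mulrDl -hl.
(* With [s] the limit, both sides of [s + s = 1 - h + s * s] are subtracted from [1 + s * s], which
   completes the square [(1 - s) * (1 - s) = h]. *)
move=> /(congr1 (fun y => 1 + slim u * slim u - y)).
rewrite [X in _ - X = _]addrC [X in _ = _ - X]addrC.
rewrite [in RHS]opprD addrA addrK opprB addrCA subrr addr0 => e; rewrite -[RHS]e.
rewrite /csqrt -/u mulrBl mul1r mulrBr mulr1 opprB opprD !addrA.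
by congr (_ - _); rewrite addrAC.
Qed.

Lemma csqrt_star : star h = h -> star (csqrt h) = csqrt h.
Proof.
move=> sh; rewrite /csqrt -/u starB star1; congr (_ - _).
apply: (tends_uniq (tends_star ul)).
suff e n : star (u n) = u n by under eq_fun do rewrite e.
elim: n => [|n IH]; first exact: star0.
by rewrite /u /= starM star_rs -rsC starD starM -/(u n) IH starB star1 sh.
Qed.

(** Every iterate is a real polynomial in [h]. This will keep roots of matrices over the range of
    [E] inside that range. *)
Lemma csqrt_closed (S : set A) :
  (forall x y, S x -> S y -> S (x + y)) ->
  (forall x y, S x -> S y -> S (x * y)) ->
  (forall t, S (rs t)) ->
  (forall v l, (forall n, S (v n)) -> tends v l -> S l) ->
  S h -> S (csqrt h).
Proof.
move=> SD SM Ss Sl Sh.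
have SN x : S x -> S (- x).
  by move=> Sx; rewrite -mulN1r -rs1 -rsN; exact: SM.
have S1 : S 1 by rewrite -rs1.
apply: (SD _ _ S1 (SN _ (Sl _ _ _ ul))); elim => [|n IH].
  by have := Ss 0; rewrite rs0.
exact: SM _ _ (Ss _) (SD _ _ (SD _ _ S1 (SN _ Sh)) (SM _ _ IH IH)).
Qed.

End Properties.

(** The relation [a * h = k * a] passes to all iterates, then to the limit. The case [h = k] is
    commutation; distinct [h] and [k] serve to compare [star c * c] with [c * star c]. *)
Lemma csqrt_comm a h k : nrm (1 - h) <= 1 -> nrm (1 - k) <= 1 ->
  a * h = k * a -> a * csqrt h = csqrt k * a.
Proof.
move=> h1 k1 ahk; rewrite /csqrt mulrBr mulrBl mulr1 mul1r; congr (_ - _).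
apply: (tends_uniq (tendsMl a (sqit_cvg h1))).
suff e n : a * sqit (1 - h) n = sqit (1 - k) n * a.
  by under eq_fun do rewrite e; apply: tendsMr; exact: sqit_cvg.
elim: n => [|n IH]; first by rewrite /= mulr0 mul0r.
rewrite /= mulrA -[a * _]rsC -!mulrA; congr (_ * _).
rewrite mulrDr mulrDl mulrBr mulrBl mulr1 mul1r ahk; congr (_ + _).
by rewrite mulrA IH -mulrA IH mulrA.
Qed.

End SquareRoot.

(** * Positive elements without spectral theory *)

Section Positivity.
Variables (R : realType) (A : ucstarType R).
Implicit Types (x y z h a b : A) (t : R).

Definition pos h : Prop := exists2 z, star z = z & h = z * z.

Lemma mulr_rs t u x y : (rs t * x) * (rs u * y) = rs (t * u) * (x * y).
Proof. by rewrite -mulrA [x * _]mulrA -[x * _]rsC -!mulrA mulrA -rsM. Qed.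

Lemma pos_star h : pos h -> star h = h.
Proof. by move=> [z sz ->]; rewrite starM sz. Qed.

Lemma pos0 : pos 0.
Proof. by exists 0; rewrite ?star0 ?mul0r. Qed.

Lemma star_add_im a b : star a = a -> star b = b -> a * b = b * a ->
  star (a + im * b) * (a + im * b) = a * a + b * b.
Proof.
move=> sa sb ab; rewrite starD starM star_im sa sb.
have -> : (a + b * - im) * (a + im * b) =
  a * a + ((a * im) * b - b * im * a - b * (im * im) * b) by ncring.
rewrite -imC -mulrA ab -[b * im]imC -[im * b * a]mulrA subrr sub0r imM.
by ncring.
Qed.

(** [a] is the real part of [w = a + im * b], and [star w * w = a * a + b * b] since [a] and [b]
    commute. *)
Lemma nrm_comm_le a b : star a = a -> star b = b -> a * b = b * a ->
  nrm a ^+ 2 <= nrm (a * a + b * b).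
Proof.
move=> sa sb ab; rewrite -star_add_im // nrm_starM ler_sqr ?nnegrE ?nrm_ge0 //.
set w := a + im * b.
have -> : a = rs 2^-1 * (w + star w).
  rewrite /w starD starM star_im sa sb.
  have -> : a + im * b + (a + b * - im) = a + a + (im * b - b * im) by ncring.
  rewrite imC subrr addr0 mulrDr -mulrDl -rsD (_ : _ + _ = 1); last by field.
  by rewrite rs1 mul1r.
rewrite nrm_rs ?invr_ge0 // ler_pdivrMl // mulr_natl mulr2n.
by rewrite (le_trans (nrmD _ _)) // nrm_star.
Qed.

(* With [w] the square root of [1 - z^2], the element [z + i w] is unitary. *)
Lemma nrm_sub_sqr z : star z = z -> nrm z <= 1 -> nrm (1 - z * z) <= 1.
Proof.
move=> sz z1.
have h1 : nrm (1 - (1 - z * z)) <= 1.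
  by rewrite opprB addrCA subrr addr0 nrm_sqr // expr_le1 ?nrm_ge0.
have sh : star (1 - z * z) = 1 - z * z by rewrite starB star1 starM sz.
have sw := csqrt_star h1 sh; have ww := csqrtM h1.
have zw : csqrt (1 - z * z) * z = z * csqrt (1 - z * z).
  by apply/esym/csqrt_comm => //; ncring.
have := nrm_comm_le sw sz zw; rewrite ww subrK -nrm_sqr // ww => h.
exact: le_trans h (nrm1_le A).
Qed.

Lemma pos_csqrt h : star h = h -> nrm (1 - h) <= 1 -> pos h.
Proof.
by move=> sh h1; exists (csqrt h); rewrite ?csqrtM //; exact: csqrt_star.
Qed.

Lemma pos_rs t h : 0 <= t -> pos h -> pos (rs t * h).
Proof.
move=> t0 [z sz ->]; exists (rs (Num.sqrt t) * z).
  by rewrite starM star_rs sz rsC.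
by rewrite mulr_rs -[Num.sqrt t * _]expr2 sqr_sqrtr.
Qed.

Lemma pos_scale t h : 0 < t -> pos h -> nrm h <= t -> nrm (1 - rs t^-1 * h) <= 1.
Proof.
move=> t0 ph ht.
have [z sz e] := pos_rs (ltW (divr_gt0 ltr01 t0)) ph.
rewrite div1r in e; rewrite e; apply: nrm_sub_sqr => //.
rewrite -(ler_pXn2r (n := 2)) ?nnegrE ?nrm_ge0 // -nrm_sqr // -e.
rewrite nrm_rs ?invr_ge0 ?(ltW t0) //.
by rewrite expr1n ler_pdivrMl ?mulr1.
Qed.

Lemma pos_unscale t h : 0 < t -> star h = h -> nrm (1 - rs t^-1 * h) <= 1 -> pos h.
Proof.
move=> t0 sh h1; rewrite -(rsVK h (lt0r_neq0 t0)); apply: pos_rs; first exact: ltW.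
by apply: pos_csqrt => //; rewrite starM star_rs sh rsC.
Qed.

Lemma nrm1B t h : 0 < t -> (nrm (1 - rs t^-1 * h) <= 1) = (nrm (rs t - h) <= t).
Proof.
move=> t0; rewrite -(ler_pM2l t0) mulr1 -nrm_rs; last exact: ltW.
by rewrite mulrBr mulr1 rsVK // lt0r_neq0.
Qed.

(** With its converse [nrm_le_pos], this replaces positivity by a norm inequality, which is stable
    under sums and limits. *)
Lemma pos_nrm_le t h : pos h -> 0 < t -> nrm h <= t -> nrm (rs t - h) <= t.
Proof. by move=> ph t0 ht; rewrite -nrm1B // pos_scale. Qed.

Lemma nrm_le_pos t h : star h = h -> 0 < t -> nrm (rs t - h) <= t -> pos h.
Proof. by move=> sh t0; rewrite -nrm1B //; exact: pos_unscale. Qed.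

(** The norm criterion is additive: bounds by [t] on [rs t - h] and [rs t - k] give a bound by
    [t + t] on the sum. The summand 1 in [t] keeps it nonzero. *)
Lemma posD h k : pos h -> pos k -> pos (h + k).
Proof.
move=> ph pk; pose t := nrm h + nrm k + 1.
have t0 : 0 < t by have := nrm_ge0 h; have := nrm_ge0 k; rewrite /t; lra.
apply: (@nrm_le_pos (t + t)); first by rewrite starD !pos_star.
  exact: addr_gt0.
rewrite rsD opprD addrACA (le_trans (nrmD _ _)) // lerD // pos_nrm_le //.
  by have := nrm_ge0 k; rewrite /t; lra.
by have := nrm_ge0 h; rewrite /t; lra.
Qed.

Lemma pos_sum (I : Type) (r : seq I) (P : pred I) (F : I -> A) :
  (forall i, P i -> pos (F i)) -> pos (\sum_(i <- r | P i) F i).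
Proof.
by move=> pF; elim/big_ind: _ => //; [exact: pos0|exact: posD].
Qed.

(** A single [t] dominates all the norms, so the norm criterion passes to the limit. *)
Lemma pos_archi h k : (forall n, pos (h + rs n.+1%:R^-1 * k)) -> pos h.
Proof.
move=> phk; pose t := nrm h + nrm k + 1.
have t0 : 0 < t by have := nrm_ge0 h; have := nrm_ge0 k; rewrite /t; lra.
have n1 n : 0 < n.+1%:R^-1 :> R by rewrite invr_gt0.
have cv : tends (fun n => h + rs n.+1%:R^-1 * k) h.
  apply: (@tends_le _ _ _ _ (fun n => n.+1%:R^-1 * nrm k)) => [n|].
    by rewrite addrC addKr nrm_rs // ltW.
  by have := cvgM (@cvg_harmonic R) (cvg_cst (nrm k)); rewrite mul0r; exact.
apply: (@nrm_le_pos t) => //.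
  apply: (tends_uniq (tends_star cv)).
  by under eq_fun do rewrite pos_star //.
apply: (tends_nrm_le (tendsD (tends_cst (rs t)) (tendsN cv))) => n.
apply: pos_nrm_le => //; rewrite (le_trans (nrmD _ _)) // nrm_rs ?(ltW (n1 _)) //.
have : n.+1%:R^-1 * nrm k <= nrm k by rewrite ler_piMl ?nrm_ge0 // invf_le1 // ler1n.
by move: (_ * nrm k) => s sk; rewrite /t; lra.
Qed.

(** Rescaling by [t] brings [h] into the domain of [csqrt]; the root commutes with all that commutes
    with [h], by [csqrt_comm]. *)
Lemma pos_sqrt h : pos h ->
  exists z, [/\ star z = z, z * z = h & forall y, y * h = h * y -> y * z = z * y].
Proof.
move=> ph; pose t := nrm h + 1.
have t0 : 0 < t by have := nrm_ge0 h; rewrite /t; lra.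
have ht : nrm h <= t by rewrite /t; lra.
have h1 := pos_scale t0 ph ht.
have sh : star (rs t^-1 * h) = rs t^-1 * h by rewrite starM star_rs pos_star // rsC.
exists (rs (Num.sqrt t) * csqrt (rs t^-1 * h)); split.
- by rewrite starM star_rs csqrt_star // -rsC.
- rewrite mulr_rs -[Num.sqrt t * _]expr2 sqr_sqrtr ?(ltW t0) // csqrtM //.
  by rewrite rsVK // lt0r_neq0.
- move=> y yh; rewrite mulrA -[y * _]rsC -!mulrA; congr (_ * _).
  by apply: csqrt_comm => //; rewrite mulrA -[y * _]rsC -!mulrA yh.
Qed.

(** Write [h = a * a] and [- h = b * b] with [a], [b] commuting and self-adjoint; then
    [nrm a ^+ 2 <= nrm (a * a + b * b) = 0]. *)
Lemma pos_antisym h : pos h -> pos (- h) -> h = 0.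
Proof.
move=> ph [b sb hb].
have [a [sa aa ac]] := pos_sqrt ph.
have hbb : h = - (b * b) by rewrite -hb opprK.
have ab : b * a = a * b by apply: ac; rewrite hbb; ncring.
have w0 : a + im * b = 0.
  by apply: starM_eq0; rewrite star_add_im // aa -hb subrr.
have := nrm_comm_le sa sb (esym ab); rewrite aa -hb subrr nrm0 => a0.
rewrite -aa (_ : a = 0) ?mul0r //; apply: nrm_eq0; apply/eqP.
by rewrite -sqrf_eq0 eq_le a0 sqr_ge0.
Qed.

Lemma pos_eq0_add h k : pos h -> pos k -> h + k = 0 -> h = 0.
Proof.
move=> ph pk hk; apply: pos_antisym => //.
by rewrite (_ : - h = k) //; apply/eqP; rewrite eq_sym -addr_eq0 addrC hk.
Qed.

Lemma pos_rsB t h : 0 <= t -> star h = h -> nrm h <= t -> pos (rs t - h).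
Proof.
rewrite le_eqVlt => /orP[/eqP <-|t0] sh ht.
  have -> : h = 0 by apply: nrm_eq0; apply/eqP; rewrite eq_le ht nrm_ge0.
  by rewrite rs0 subrr; exact: pos0.
apply: (@nrm_le_pos t) => //; first by rewrite starB star_rs sh.
by rewrite opprB addrCA subrr addr0.
Qed.

(** Again by commuting roots: [h = a * a] and [rs t - h = b * b] have sum [rs t], whose norm is at
    most [t]. *)
Lemma pos_nrm_bound t h : 0 <= t -> pos h -> pos (rs t - h) -> nrm h <= t.
Proof.
move=> t0 ph [b sb hb].
have [a [sa aa ac]] := pos_sqrt ph.
have ab : b * a = a * b.
  have bh : h = rs t - b * b by rewrite -hb; ncring.
  by apply: ac; rewrite bh mulrBr mulrBl rsC; ncring.
have := nrm_comm_le sa sb (esym ab); rewrite aa -hb addrCA subrr addr0.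
by rewrite -nrm_sqr // aa => /le_trans; apply; exact: nrm_rs1.
Qed.

Lemma pos_nrm_mono h k : pos h -> pos (k - h) -> nrm h <= nrm k.
Proof.
move=> ph pkh; apply: pos_nrm_bound => //; first exact: nrm_ge0.
have pk : pos k by rewrite -(subrK h k); exact: posD.
rewrite (_ : _ - h = (rs (nrm k) - k) + (k - h)); last by ncring.
by apply: posD => //; apply: pos_rsB; rewrite ?nrm_ge0 ?pos_star.
Qed.

(** * Positivity of [star b * b] *)

(** Uniqueness of the positive root. With [d = g - p], the positive elements [d * g * d] and
    [d * p * d] have sum 0, so both vanish, their difference [d * d * d] is 0, and [d = 0]. *)
Lemma csqrt_sqr p : pos p -> nrm p <= 1 -> csqrt (p * p) = p.
Proof.
move=> pp p1; set g := csqrt (p * p).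
have sp := pos_star pp.
have h1 : nrm (1 - p * p) <= 1 by exact: nrm_sub_sqr.
have gg : g * g = p * p by exact: csqrtM.
have gc y : y * (p * p) = p * p * y -> y * g = g * y by move=> e; exact: csqrt_comm.
have gp : p * g = g * p by apply: gc; rewrite mulrA.
have sg : star g = g by apply: csqrt_star => //; rewrite starM sp.
have g1 : nrm (1 - g) <= 1 by exact: csqrt_le.
clearbody g.
have [k [sk kk kc]] := pos_sqrt (pos_csqrt sg g1).
have [r [sr rr rc]] := pos_sqrt pp.
pose d := g - p.
have sd : star d = d by rewrite starB sg sp.
have conj_pos (z y : A) : star z = z -> z * z = y -> d * z = z * d -> pos (d * y * d).
  move=> sz <- dz; exists (d * z); first by rewrite starM sz sd.
  by rewrite {2}dz !mulrA.
have p1' : pos (d * g * d).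
  by apply: (conj_pos k) => //; apply: kc; rewrite /d mulrBl mulrBr gp.
have p2' : pos (d * p * d).
  by apply: (conj_pos r) => //; apply: rc; rewrite /d mulrBl mulrBr gp.
have s0 : d * g * d + d * p * d = 0.
  rewrite -mulrDl -mulrDr.
  have -> : d * (g + p) = (g * g - p * p) + (g * p - p * g) by rewrite /d; ncring.
  by rewrite gg gp !subrr addr0 mul0r.
have e1 := pos_eq0_add p1' p2' s0.
have e2 : d * p * d = 0 by move: s0; rewrite e1 add0r.
have d3 : d * d * d = 0.
  have -> : d * d * d = d * g * d - d * p * d by rewrite {2}/d; ncring.
  by rewrite e1 e2 subrr.
have d0 : d = 0.
  apply: sqr_eq0 => //; apply: sqr_eq0; first by rewrite starM sd.
  by rewrite mulrA d3 mul0r.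
by apply/eqP; rewrite -subr_eq0 -/d d0.
Qed.

Section Jordan.
Variable h : A.
Hypothesis (sh : star h = h) (h1 : nrm h <= 1).

(** The absolute value of a self-adjoint contraction. *)
Definition cabsv : A := csqrt (h * h).

Let hh1 : nrm (1 - h * h) <= 1. Proof. exact: nrm_sub_sqr. Qed.

Lemma cabsv_small : nrm (1 - cabsv) <= 1.
Proof. exact: csqrt_le. Qed.

Lemma cabsv_sqr : cabsv * cabsv = h * h.
Proof. exact: csqrtM. Qed.

Lemma cabsv_star : star cabsv = cabsv.
Proof. by apply: csqrt_star; rewrite // starM sh. Qed.

Lemma cabsv_comm : h * cabsv = cabsv * h.
Proof. by apply: csqrt_comm; rewrite // mulrA. Qed.

Lemma cabsv_pos : pos cabsv.
Proof. exact: pos_csqrt cabsv_star cabsv_small. Qed.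

Lemma nrm_cabsv : nrm cabsv = nrm h.
Proof.
apply/eqP; rewrite -(eqrXn2 (n := 2)) ?nrm_ge0 //.
by rewrite -!nrm_sqr ?cabsv_sqr //; exact: cabsv_star.
Qed.

(* Twice the negative part of [h]. *)
Definition cneg : A := cabsv - h.

Lemma cneg_star : star cneg = cneg.
Proof. by rewrite starB cabsv_star sh. Qed.

(** With [m = cneg], [h * m = - (cabsv * m)], so [- (m * h * m) = m * cabsv * m] is the square of
    this self-adjoint element. *)
Definition cnegq : A := csqrt cabsv * cneg.

Lemma cnegq_comm : csqrt cabsv * cneg = cneg * csqrt cabsv.
Proof.
apply/esym/csqrt_comm; [exact: cabsv_small..|].
by rewrite /cneg [LHS]mulrBl [RHS]mulrBr cabsv_comm.
Qed.

Lemma cnegq_star : star cnegq = cnegq.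
Proof.
rewrite /cnegq starM cneg_star csqrt_star ?cnegq_comm //.
  exact: cabsv_small.
exact: cabsv_star.
Qed.

Lemma cneg_conj : cneg * h * cneg = - (cnegq * cnegq).
Proof.
have e : h * cneg = - (cabsv * cneg).
  move: cabsv_comm cabsv_sqr; rewrite /cneg; move: cabsv => v hv vv.
  by rewrite !mulrBr hv -vv; ncring.
rewrite -mulrA e mulrN; congr (- _).
by rewrite {1}/cnegq cnegq_comm /cnegq !mulrA -[cneg * _ * _]mulrA csqrtM // cabsv_small.
Qed.

(** Then [cabsv * cneg] and [h * cneg] both vanish, and so does their difference, the square of
    [cneg]. *)
Lemma cneg_eq0 : cnegq = 0 -> h = cabsv.
Proof.
move=> q0; suff m0 : cneg = 0 by apply/esym/eqP; rewrite -subr_eq0 -/cneg m0.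
apply: sqr_eq0; first exact: cneg_star.
have am : cabsv * cneg = 0.
  by rewrite -[cabsv](csqrtM cabsv_small) -mulrA -/cnegq q0 mulr0.
have hm : h * cneg = 0.
  rewrite -[RHS]oppr0 -am; move: cabsv_comm cabsv_sqr; rewrite /cneg.
  by move: cabsv => v hv vv; rewrite !mulrBr hv -vv; ncring.
by rewrite {1}/cneg mulrBl am hm subrr.
Qed.

End Jordan.

(* If [star c * c = - p] with [p] positive, intertwining turns [p + star c * c = 0]
   into [star c * (|c star c| + c star c) = 0]. *)
Lemma neg_starM_swap c : nrm c <= 1 -> pos (- (star c * c)) -> pos (- (c * star c)).
Proof.
move=> c1 pp; set s := c * star c; set p := - (star c * c).
have c2 : nrm c ^+ 2 <= 1 by rewrite expr_le1 // nrm_ge0.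
have ss : star s = s by rewrite starM starK.
have s1 : nrm s <= 1.
  by rewrite (le_trans (nrmM _ _)) // nrm_star -expr2.
have p1 : nrm p <= 1 by rewrite nrmN nrm_starM.
have e : star c * cabsv s = p * star c.
  (* Since [p] is the root of [p * p], it suffices to intertwine the squares:
     [star c * (s * s) = (p * p) * star c]. *)
  rewrite -[p](csqrt_sqr pp p1); apply: csqrt_comm; try exact: nrm_sub_sqr.
    by apply: nrm_sub_sqr => //; exact: pos_star.
  by rewrite /s /p; ncring.
have e0 : star c * (cabsv s + s) = 0.
  by rewrite mulrDr e /p /s; ncring.
have e1 : s * (cabsv s + s) = 0 by rewrite {1}/s -mulrA e0 mulr0.
suff d0 : cabsv s + s = 0.
  rewrite (_ : - s = cabsv s); first exact: cabsv_pos.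
  by apply/esym/eqP; rewrite -addr_eq0 d0.
(* By [e1] the square reduces to [cabsv s * (cabsv s + s)], which equals [s * (s + cabsv s)] and
   vanishes by [e1] again. *)
apply: sqr_eq0; first by rewrite starD cabsv_star ?ss.
rewrite mulrDl e1 addr0 mulrDr cabsv_sqr // -cabsv_comm // -mulrDr.
by rewrite addrC.
Qed.

(** Up to real factors, [x] and [y] are the real and imaginary parts of [c]. *)
Lemma starM_add_swap c : pos (star c * c + c * star c).
Proof.
pose x := c + star c; pose y := im * (c - star c).
have -> : star c * c + c * star c = rs 2^-1 * (x * x) + rs 2^-1 * (y * y).
  rewrite -mulrDr (_ : x * x + y * y = rs 2 * (star c * c + c * star c)).
    by rewrite rsK.
  rewrite rs_nat /x /y mulrA -[im * _ * im]mulrA -imC mulrA imM mulr_natl mulr2n; ncring.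
have h0 : 0 <= 2^-1 :> R by rewrite invr_ge0.
apply: posD; apply: pos_rs => //; [exists x|exists y] => //.
  by rewrite /x starD starK addrC.
rewrite /y starM star_im starB starK imC; ncring.
Qed.

(** Let [h = star b * b] and [c = b * cneg h]. Then [star c * c = cneg h * h * cneg h] is minus a
    square, hence so is [c * star c]; as their sum is positive, [star c * c] is also positive, hence
    0. So [cnegq h = 0] and [h = cabsv h]. *)
Theorem pos_starM b : pos (star b * b).
Proof.
(* The bound makes both [h] and [c] below contractions. *)
wlog b1 : b / nrm b <= 2^-1.
  move=> hw; pose t := 2 * (nrm b + 1).
  have t0 : 0 < t by rewrite /t; have := nrm_ge0 b; lra.
  have : pos (star (rs t^-1 * b) * (rs t^-1 * b)).
    apply: hw; rewrite nrm_rs ?invr_ge0 ?(ltW t0) // ler_pdivrMl //.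
    by rewrite /t; have := nrm_ge0 b; lra.
  rewrite starM star_rs -rsC mulr_rs.
  move=> /(pos_rs (ltW (mulr_gt0 t0 t0))).
  by rewrite -invfM rsVK // mulf_neq0 // lt0r_neq0.
set h := star b * b.
have sh : star h = h by rewrite starM starK.
have h1 : nrm h <= 2^-1.
  rewrite nrm_starM; have := nrm_ge0 b; nra.
have h1' : nrm h <= 1 by lra.
pose c := b * cneg h.
have sm := cneg_star sh h1'.
have cc : star c * c = - (cnegq h * cnegq h).
  by rewrite -cneg_conj // /c starM sm !mulrA.
have c1 : nrm c <= 1.
  rewrite (le_trans (nrmM _ _)) //.
  have : nrm (cneg h) <= nrm h + nrm h by rewrite (le_trans (nrmB _ _)) // nrm_cabsv.
  have := nrm_ge0 b; have := nrm_ge0 (cneg h); nra.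
have pc : pos (- (star c * c)).
  by rewrite cc opprK; exists (cnegq h) => //; exact: cnegq_star.
have c0 : star c * c = 0.
  apply: pos_antisym => //.
  rewrite (_ : _ * _ = (star c * c + c * star c) + - (c * star c)); last by rewrite addrK.
  by apply: posD; [exact: starM_add_swap|exact: neg_starM_swap].
have q0 : cnegq h = 0.
  apply: sqr_eq0; first exact: cnegq_star.
  by apply/eqP; rewrite -oppr_eq0 -cc c0.
by rewrite (cneg_eq0 sh h1' q0); exact: cabsv_pos.
Qed.

End Positivity.

(** * Operator norms *)

Section OperatorNorm.
Variables (R : realType) (A : pzRingType) (V : Type).
Variables (nv : V -> R) (act : A -> V -> V).
Implicit Types (x y : A) (v : V) (c : R).

Definition opbound x : set R :=
  [set c | 0 <= c /\ forall v, nv (act x v) <= c * nv v].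

(** Gives the norm both of the unitization and of the matrix algebra, from their actions on pairs
    and on columns. *)
Definition opn x : R := inf (opbound x).

Hypothesis nv_ge0 : forall v, 0 <= nv v.
Hypothesis bounded : forall x, opbound x !=set0.

Lemma opn_ge0 x : 0 <= opn x.
Proof. by apply: lb_le_inf => // c []. Qed.

Lemma opn_bound x v : nv (act x v) <= opn x * nv v.
Proof.
have [v0|v0] := eqVneq (nv v) 0.
  by have [c [_ /(_ v)]] := bounded x; rewrite v0 !mulr0.
have vp : 0 < nv v by rewrite lt_def v0 nv_ge0.
rewrite -ler_pdivrMr //; apply: lb_le_inf => // c [_ /(_ v)].
by rewrite -ler_pdivrMr.
Qed.

Lemma opn_le x c : 0 <= c -> (forall v, nv (act x v) <= c * nv v) -> opn x <= c.
Proof. by move=> c0 xc; apply: ge_inf => //; exists 0 => d []. Qed.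

Lemma opnD x y :
  (forall v, nv (act (x + y) v) <= nv (act x v) + nv (act y v)) ->
  opn (x + y) <= opn x + opn y.
Proof.
move=> xy; apply: opn_le => [|v]; first by rewrite addr_ge0 ?opn_ge0.
by rewrite mulrDl (le_trans (xy v)) // lerD ?opn_bound.
Qed.

Lemma opnM x y :
  (forall v, act (x * y) v = act x (act y v)) -> opn (x * y) <= opn x * opn y.
Proof.
move=> xy; apply: opn_le => [|v]; first by rewrite mulr_ge0 ?opn_ge0.
rewrite xy (le_trans (opn_bound _ _)) // -mulrA ler_wpM2l ?opn_ge0 //.
exact: opn_bound.
Qed.

(** Meant for [y = star x * x]: a Cauchy-Schwarz bound on vectors yields the C*-inequality for
    operators. *)
Lemma opn_sqr_le x y :
  (forall v, nv (act x v) ^+ 2 <= nv v * nv (act y v)) -> opn x ^+ 2 <= opn y.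
Proof.
move=> xy; rewrite -[leRHS]sqr_sqrtr ?opn_ge0 //.
rewrite ler_pXn2r ?nnegrE ?sqrtr_ge0 ?opn_ge0 //.
apply: opn_le => [|v]; first exact: sqrtr_ge0.
rewrite -(ler_pXn2r (n := 2)) ?nnegrE ?mulr_ge0 ?sqrtr_ge0 //.
rewrite exprMn sqr_sqrtr ?opn_ge0 // (le_trans (xy v)) //.
by rewrite expr2 mulrA [leRHS]mulrC ler_wpM2l // opn_bound.
Qed.

End OperatorNorm.

(** * Completeness in terms of Cauchy sequences *)

Lemma cauchy_seq_cvg (K : numFieldType) (V : completeNormedModType K)
    (u : nat -> V) :
  (forall e : K, 0 < e -> exists N, forall m n, (N <= m)%N -> (N <= n)%N ->
     `|u m - u n| < e) ->
  exists l : V, u @ \oo --> l.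
Proof.
move=> uc; apply/cvg_ex; apply: cauchy_cvg.
apply: cauchy_exP => e e0; have [N hN] := uc e e0.
exists (u N); exists N => // n Nn /=.
by rewrite -ball_normE /=; apply: hN => //; exact: leqnn.
Qed.

Lemma complex_complete (R : realType) (k : nat -> R[i]) :
  (forall e : R, 0 < e -> exists N, forall m n, (N <= m)%N -> (N <= n)%N ->
     cabs (k m - k n) < e) ->
  exists l, (fun n => cabs (k n - l)) @ \oo --> (0 : R).
Proof.
move=> kc.
have Rele (z : R[i]) : `|complex.Re z| <= cabs z.
  by rewrite -lecR cabsE normc_ge_Re.
have Imle (z : R[i]) : `|complex.Im z| <= cabs z.
  by rewrite -normrN -ReiNIm (le_trans (Rele _)) // cabsM complexiE cabsi mulr1.
have [|a ha] := @cauchy_seq_cvg R R (fun n => complex.Re (k n)).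
  move=> e /kc[N hN]; exists N => m n Nm Nn.
  by rewrite -raddfB (le_lt_trans (Rele _)) // hN.
have [|b hb] := @cauchy_seq_cvg R R (fun n => complex.Im (k n)).
  move=> e /kc[N hN]; exists N => m n Nm Nn.
  by rewrite -raddfB (le_lt_trans (Imle _)) // hN.
exists (a +i* b)%C.
pose v n := `|complex.Re (k n) - a| + `|complex.Im (k n) - b|.
apply: (squeeze_cvgr _ (cvg_cst (0:R)) (_ : v @ \oo --> 0)).
  apply: nearW => n; rewrite cabs_ge0 /= /v.
  case: (k n) => x y /=.
  rewrite [X in cabs X]complexE /= (le_trans (cabsD _ _)) // cabsM complexiE cabsi mul1r.
  by rewrite lerD // /cabs normc_def /= expr0n addr0 sqrtr_sqr.
have h (f : nat -> R) c : f @ \oo --> c -> (fun n => `|f n - c|) @ \oo --> 0.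
  by move=> /subr_cvg0 /cvg_norm; rewrite normr0.
have := cvgD (h _ _ ha) (h _ _ hb); rewrite addr0; exact.
Qed.

(** * Real norm and arithmetic of a C*-algebra without unit *)

Section RealNorm.
Variables (R : realType) (C : cstarAlgType R).
Implicit Types (a b : C) (k : R[i]).

Definition cn a : R := complex.Re `|a|.

Lemma cnE a : (cn a)%:C = `|a|.
Proof. by rewrite /cn RRe_real // normr_real. Qed.
Lemma cn_ge0 a : 0 <= cn a.
Proof. by rewrite -ler0c cnE. Qed.
Lemma cn_eq0 a : cn a = 0 -> a = 0.
Proof. by move=> a0; apply/normr0_eq0; rewrite -cnE a0. Qed.
Lemma cn0 : cn 0 = 0.
Proof. by rewrite /cn normr0. Qed.
Lemma cnD a b : cn (a + b) <= cn a + cn b.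
Proof. by rewrite -lecR rmorphD /= !cnE ler_normD. Qed.
Lemma cnN a : cn (- a) = cn a.
Proof. by rewrite /cn normrN. Qed.
Lemma cnZ k a : cn (k *: a) = cabs k * cn a.
Proof. by apply: complexI; rewrite rmorphM /= cabsE !cnE normrZ. Qed.
Lemma cn_cmul a b : cn (cmul a b) <= cn a * cn b.
Proof. by rewrite -lecR rmorphM /= !cnE norm_cmul_le. Qed.
Lemma cn_starM a : cn (cmul (cstar a) a) = cn a ^+ 2.
Proof. by apply: complexI; rewrite rmorphXn /= !cnE norm_cstar_cmul. Qed.
Lemma cn_star a : cn (cstar a) = cn a.
Proof.
have h b : cn b <= cn (cstar b).
  have [b0|b0] := eqVneq (cn b) 0; first by rewrite b0 cn_ge0.
  have b_gt0 : 0 < cn b by rewrite lt_def b0 cn_ge0.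
  by rewrite -(ler_pM2r b_gt0) -expr2 -cn_starM cn_cmul.
by apply/eqP; rewrite eq_le h -{2}[a]cstarK h.
Qed.

Lemma cn_complete (u : nat -> C) :
  (forall e : R, 0 < e -> exists N, forall m n, (N <= m)%N -> (N <= n)%N ->
     cn (u m - u n) < e) ->
  exists l, (fun n => cn (u n - l)) @ \oo --> (0 : R).
Proof.
move=> uc; have [|l ul] := @cauchy_seq_cvg R[i] C u.
  move=> e e0; have [|N hN] := uc (complex.Re e).
    by move: e0; rewrite ltcE => /andP[].
  exists N => m n Nm Nn; have := hN m n Nm Nn.
  by rewrite -ltcR cnE RRe_real // gtr0_real.
exists l; apply/cvgrPdist_lt => e e0.
have /cvgrPdist_lt/(_ e%:C) := ul.
rewrite (_ : (0 < e%:C) = (0 < e)) ?ltcR // => /(_ e0) [N _ hN].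
exists N => // n Nn; rewrite sub0r normrN ger0_norm ?cn_ge0 //.
by have := hN n Nn; rewrite distrC -cnE ltcR.
Qed.

Lemma cmul0r a : cmul 0 a = 0.
Proof. by apply: (addIr (cmul 0 a)); rewrite -cmulDl !add0r. Qed.
Lemma cmulr0 a : cmul a 0 = 0.
Proof. by apply: (addIr (cmul a 0)); rewrite -cmulDr !add0r. Qed.
Lemma cmulNr a b : cmul (- a) b = - cmul a b.
Proof. by apply: (addIr (cmul a b)); rewrite -cmulDl !addNr cmul0r. Qed.
Lemma cmulrN a b : cmul a (- b) = - cmul a b.
Proof. by apply: (addIr (cmul a b)); rewrite -cmulDr !addNr cmulr0. Qed.
Lemma cmulBl a b c : cmul (a - b) c = cmul a c - cmul b c.
Proof. by rewrite cmulDl cmulNr. Qed.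
Lemma cmulBr a b c : cmul a (b - c) = cmul a b - cmul a c.
Proof. by rewrite cmulDr cmulrN. Qed.
Lemma cmul_suml (I : Type) (r : seq I) (P : pred I) (F : I -> C) b :
  cmul (\sum_(i <- r | P i) F i) b = \sum_(i <- r | P i) cmul (F i) b.
Proof. exact: (big_morph (cmul^~ b) (fun x y => cmulDl x y b) (cmul0r b)). Qed.
Lemma cmul_sumr (I : Type) (r : seq I) (P : pred I) (F : I -> C) b :
  cmul b (\sum_(i <- r | P i) F i) = \sum_(i <- r | P i) cmul b (F i).
Proof. exact: (big_morph (cmul b) (cmulDr b) (cmulr0 b)). Qed.
Lemma cstar0 : cstar (0 : C) = 0.
Proof. by apply: (addIr (cstar 0)); rewrite -cstarD !add0r. Qed.
Lemma cstarN a : cstar (- a) = - cstar a.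
Proof. by apply: (addIr (cstar a)); rewrite -cstarD !addNr cstar0. Qed.
Lemma cstarB a b : cstar (a - b) = cstar a - cstar b.
Proof. by rewrite cstarD cstarN. Qed.
Lemma cstar_sum (I : Type) (r : seq I) (P : pred I) (F : I -> C) :
  cstar (\sum_(i <- r | P i) F i) = \sum_(i <- r | P i) cstar (F i).
Proof. exact: (big_morph (@cstar R C) (@cstarD R C) cstar0). Qed.

End RealNorm.

(** * The unitization as a unital C*-algebra *)

Definition unitization (R : realType) (C : cstarAlgType R) : Type := (C * R[i])%type.

Section Unitization.
Variables (R : realType) (C : cstarAlgType R).
Local Notation D := (unitization C).
Implicit Types (x y v w : D) (a b : C) (k l : R[i]).

HB.instance Definition _ := GRing.Zmodule.on D.

Definition umul x y : D :=
  (cmul x.1 y.1 + x.2 *: y.1 + y.2 *: x.1, x.2 * y.2).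
Definition uone : D := (0, 1).

Lemma unitization_eq x y : x.1 = y.1 -> x.2 = y.2 -> x = y.
Proof. by case: x y => [a k] [b l] /= -> ->. Qed.

Let umulA : associative umul.
Proof.
move=> x y z; apply: unitization_eq; rewrite /= ?mulrA //.
rewrite !cmulDl !cmulDr !scalerDr !cmulZl !cmulZr !scalerA cmulA.
rewrite -!addrA; congr (_ + _); rewrite [z.2 * x.2]mulrC [z.2 * y.2]mulrC.
rewrite [RHS]addrCA; congr (_ + _); rewrite [LHS]addrCA; congr (_ + _).
exact: addrCA.
Qed.

Let umul1r : left_id uone umul.
Proof.
move=> x; apply: unitization_eq; rewrite /= ?mul1r //.
by rewrite cmul0r scale1r scaler0 addr0 add0r.
Qed.

Let umulr1 : right_id uone umul.
Proof.
move=> x; apply: unitization_eq; rewrite /= ?mulr1 //.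
by rewrite cmulr0 scale1r scaler0 addr0 add0r.
Qed.

Let umulDl : left_distributive umul +%R.
Proof.
move=> x y z; apply: unitization_eq; rewrite /= ?mulrDl //.
by rewrite cmulDl scalerDl scalerDr [RHS]addrACA; congr (_ + _); exact: addrACA.
Qed.

Let umulDr : right_distributive umul +%R.
Proof.
move=> x y z; apply: unitization_eq; rewrite /= ?mulrDr //.
by rewrite cmulDr scalerDl scalerDr [RHS]addrACA; congr (_ + _); exact: addrACA.
Qed.

HB.instance Definition _ := GRing.Zmodule_isPzRing.Build D
  umulA umul1r umulr1 umulDl umulDr.

Definition uscal k : D := (0, k).
Definition ustar x : D := (cstar x.1, Num.conj x.2).

(* [D] acts diagonally on [C * R[i]]; the second summand keeps the norm definite
   when [C] already has a unit. *)
Definition uact x v : D := (cmul x.1 v.1 + x.2 *: v.1, x.2 * v.2).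
Definition unv v : R := Num.max (cn v.1) (cabs v.2).

Lemma unv_ge0 v : 0 <= unv v.
Proof. by rewrite le_max cn_ge0. Qed.

Lemma unv_leP v (c : R) : (unv v <= c) = (cn v.1 <= c) && (cabs v.2 <= c).
Proof. exact: ge_max. Qed.

Lemma cn_unv v : cn v.1 <= unv v.
Proof. by rewrite le_max lexx. Qed.
Lemma cabs_unv v : cabs v.2 <= unv v.
Proof. by rewrite le_max lexx orbT. Qed.

Lemma unvD v w : unv (v + w) <= unv v + unv w.
Proof.
rewrite unv_leP; apply/andP; split.
  by rewrite (le_trans (cnD _ _)) // lerD ?cn_unv.
by rewrite (le_trans (cabsD _ _)) // lerD ?cabs_unv.
Qed.

Lemma uact_bound x v : unv (uact x v) <= (cn x.1 + cabs x.2) * unv v.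
Proof.
rewrite unv_leP /=; apply/andP; split.
  rewrite (le_trans (cnD _ _)) // mulrDl lerD //.
    by rewrite (le_trans (cn_cmul _ _)) // ler_wpM2l ?cn_ge0 ?cn_unv.
  by rewrite cnZ ler_wpM2l ?cabs_ge0 ?cn_unv.
by rewrite cabsM ler_pM ?cabs_ge0 ?cabs_unv // lerDr cn_ge0.
Qed.

Lemma uact_bounded x : opbound unv uact x !=set0.
Proof.
exists (cn x.1 + cabs x.2); split; last exact: uact_bound.
by rewrite addr_ge0 ?cn_ge0 ?cabs_ge0.
Qed.

Definition unrm : D -> R := opn unv uact.

Lemma unrm_le x : unrm x <= cn x.1 + cabs x.2.
Proof.
by apply: opn_le; [rewrite addr_ge0 ?cn_ge0 ?cabs_ge0|exact: uact_bound].
Qed.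

Lemma cabs_unrm x : cabs x.2 <= unrm x.
Proof.
have := opn_bound unv_ge0 uact_bounded x (0, 1).
have -> : unv (0, 1) = 1 by rewrite /unv /= cn0 cabs1 (max_idPr ler01).
rewrite mulr1; apply: le_trans.
by rewrite (le_trans _ (cabs_unv _)) //= mulr1.
Qed.

(** Act on [(cstar x.1, 0)]: the square of [cn x.1] is the norm of [cmul x.1 (cstar x.1)], which
    differs from the result by [x.2 *: cstar x.1]; each of the two terms is at most
    [unrm x * cn x.1]. With [cabs_unrm], convergence is thus componentwise. *)
Lemma cn_unrm x : cn x.1 <= 2 * unrm x.
Proof.
have [x0|x0] := eqVneq (cn x.1) 0.
  by rewrite x0 mulr_ge0 // opn_ge0 //; exact: uact_bounded.
have xp : 0 < cn x.1 by rewrite lt_def x0 cn_ge0.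
have := opn_bound unv_ge0 uact_bounded x (cstar x.1, 0).
have -> : unv (cstar x.1, 0) = cn x.1.
  by rewrite /unv /= cn_star cabs0 (max_idPl (cn_ge0 _)).
move=> h.
have {h} := le_trans (cn_unv _) h; rewrite /= => h.
rewrite -(ler_pM2r xp) -expr2 -cn_star -cn_starM cstarK.
rewrite -[X in cn X](addrK (x.2 *: cstar x.1)).
rewrite (le_trans (cnD _ _)) // cnN cnZ cn_star -mulrA mulr_natl mulr2n lerD //.
by rewrite ler_wpM2r ?cn_ge0 // cabs_unrm.
Qed.

Let uscalD : {morph uscal : k l / k + l}.
Proof. by move=> k l; apply: unitization_eq; rewrite /= ?addr0. Qed.

Let uscalM : {morph uscal : k l / k * l}.
Proof.
by move=> k l; apply: unitization_eq; rewrite //= cmul0r !scaler0 !addr0.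
Qed.

Let uscalC k x : uscal k * x = x * uscal k.
Proof.
apply: unitization_eq; rewrite /= ?[k * _]mulrC //.
by rewrite cmul0r cmulr0 !scaler0 addr0 !add0r.
Qed.

Let ustarK : involutive ustar.
Proof. by move=> x; apply: unitization_eq; rewrite /= ?cstarK ?conjCK. Qed.

Let ustarD : {morph ustar : x y / x + y}.
Proof. by move=> x y; apply: unitization_eq; rewrite /= ?cstarD ?rmorphD. Qed.

Let ustarM x y : ustar (x * y) = ustar y * ustar x.
Proof.
apply: unitization_eq; rewrite /= ?rmorphM 1?mulrC //=.
by rewrite !cstarD !cstarZ cstarM addrAC.
Qed.

Let ustar_scal k : ustar (uscal k) = uscal (Num.conj k).
Proof. by apply: unitization_eq; rewrite /= ?cstar0. Qed.

Let unrm_eq0 x : unrm x = 0 -> x = 0.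
Proof.
move=> x0; apply: unitization_eq.
  by apply: cn_eq0; apply/eqP; rewrite eq_le cn_ge0 -(mulr0 2) -x0 cn_unrm.
by apply: cabs_eq0; apply/eqP; rewrite eq_le cabs_ge0 -x0 cabs_unrm.
Qed.

Let unrmD x y : unrm (x + y) <= unrm x + unrm y.
Proof.
apply: opnD => [||v]; [exact: unv_ge0|exact: uact_bounded|].
apply: le_trans (unvD _ _); rewrite le_eqVlt; apply/orP; left; apply/eqP.
congr unv; apply: unitization_eq; rewrite /= ?mulrDl //.
by rewrite cmulDl scalerDl addrACA.
Qed.

Let unrmM x y : unrm (x * y) <= unrm x * unrm y.
Proof.
apply: opnM => [||v]; [exact: unv_ge0|exact: uact_bounded|].
apply: unitization_eq; rewrite /= ?mulrA //.
rewrite !cmulDl !cmulDr !scalerDr !cmulZl !cmulZr !scalerA cmulA.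
by rewrite -!addrA; congr (_ + _); rewrite addrCA.
Qed.

Let unrm_scal k x : unrm (uscal k * x) <= cabs k * unrm x.
Proof.
have un0 : 0 <= unrm x by exact: opn_ge0 uact_bounded _.
apply: opn_le => [|v]; first by rewrite mulr_ge0 ?cabs_ge0.
have -> : uact (uscal k * x) v = (k *: (uact x v).1, k * (uact x v).2).
  apply: unitization_eq; rewrite /= ?mulrA //.
  by rewrite cmul0r scaler0 addr0 add0r cmulZl scalerDr scalerA.
rewrite -mulrA (le_trans (y := cabs k * unv (uact x v))) //.
  rewrite unv_leP cnZ cabsM; move: (uact x v) => w.
  by rewrite !ler_wpM2l ?cabs_ge0 ?cn_unv ?cabs_unv.
rewrite ler_wpM2l ?cabs_ge0 //.
exact: opn_bound unv_ge0 uact_bounded _ _.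
Qed.

Let unrm_sqr_le x : unrm x ^+ 2 <= unrm (ustar x * x).
Proof.
apply: opn_sqr_le => [||v]; [exact: unv_ge0|exact: uact_bounded|].
set w := uact x v.
suff h : cn w.1 ^+ 2 <= unv v * unv (uact (ustar x * x) v) /\
         cabs w.2 ^+ 2 <= unv v * unv (uact (ustar x * x) v).
  by case: h => h1 h2; rewrite [X in X ^+ 2]/unv maxEle; case: ifP.
split.
  (* Moving the adjoint of [x] to the right-hand factor expresses the square of [w.1] through
     [star x * x] applied to [v]. *)
  have e : cmul (cstar w.1) w.1 = cmul (cstar v.1) (uact (ustar x * x) v).1.
    have -> : (uact (ustar x * x) v).1 = cmul (cstar x.1) w.1 + Num.conj x.2 *: w.1.
      rewrite /w /= !cmulDl cmulDr !cmulZl cmulZr scalerDr scalerA cmulA -!addrA.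
      by congr (_ + _); exact: addrCA.
    have -> : cstar w.1 = cmul (cstar v.1) (cstar x.1) + Num.conj x.2 *: cstar v.1.
      by rewrite /w /= cstarD cstarM cstarZ.
    by move: w.1 => a; rewrite cmulDl cmulDr cmulA cmulZl cmulZr.
  rewrite -cn_starM e (le_trans (cn_cmul _ _)) // cn_star.
  by rewrite ler_pM ?cn_ge0 ?cn_unv.
rewrite (le_trans (y := cabs v.2 * cabs (uact (ustar x * x) v).2)) //.
  by rewrite /= !cabsM cabs_conj le_eqVlt; apply/orP; left; apply/eqP; ring.
by rewrite ler_pM ?cabs_ge0 ?cabs_unv.
Qed.

Let unrm_complete (u : nat -> D) :
  (forall e : R, 0 < e -> exists N, forall m n, (N <= m)%N -> (N <= n)%N ->
     unrm (u m - u n) < e) ->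
  exists d, (fun n => unrm (u n - d)) @ \oo --> (0 : R).
Proof.
move=> uc.
have [|a ha] := @cn_complete R C (fun n => (u n).1).
  move=> e e0; have [|N hN] := uc (e / 2); first by rewrite divr_gt0.
  exists N => m n Nm Nn; have := hN m n Nm Nn.
  by rewrite ltr_pdivlMr // mulrC; apply: le_lt_trans (cn_unrm (u m - u n)).
have [|k hk] := @complex_complete R (fun n => (u n).2).
  move=> e e0; have [N hN] := uc e e0.
  exists N => m n Nm Nn; exact: le_lt_trans (cabs_unrm (u m - u n)) (hN m n Nm Nn).
exists (a, k); pose v n := cn ((u n).1 - a) + cabs ((u n).2 - k).
have v0 : v @ \oo --> (0 : R) by have := cvgD ha hk; rewrite addr0; exact.
apply: (squeeze_cvgr _ (cvg_cst (0:R)) v0); apply: nearW => n.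
apply/andP; split; first exact: opn_ge0 uact_bounded _.
exact: unrm_le (u n - (a, k)).
Qed.

HB.instance Definition _ := isUnitalCStar.Build R D
  uscalD uscalM erefl uscalC ustarK ustarD ustarM ustar_scal
  (opn_ge0 uact_bounded) unrm_eq0 unrmD unrmM unrm_scal unrm_sqr_le unrm_complete.

End Unitization.

(** * Square matrices as a unital C*-algebra *)

Section MatrixAlgebra.
Variables (R : realType) (D : ucstarType R) (n : nat).
Local Notation M := 'M[D]_n.
Implicit Types (X Y : M) (v w : 'cV[D]_n) (a : D) (k l : R[i]).

(** The [D]-valued inner product of the standard Hilbert module; matrices are adjointable operators
    on it. *)
Definition dot v w : D := \sum_i star (v i 0) * w i 0.

Lemma star_dot v w : star (dot v w) = dot w v.
Proof. by rewrite /dot star_sum; apply: eq_bigr => i _; rewrite starM starK. Qed.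

Lemma dotDl v1 v2 w : dot (v1 + v2) w = dot v1 w + dot v2 w.
Proof.
by rewrite /dot -big_split; apply: eq_bigr => i _; rewrite mxE starD mulrDl.
Qed.

Lemma dotDr v w1 w2 : dot v (w1 + w2) = dot v w1 + dot v w2.
Proof. by rewrite /dot -big_split; apply: eq_bigr => i _; rewrite mxE mulrDr. Qed.

Definition mstar X : M := \matrix_(i, j) star (X j i).

Lemma dot_adj X v w : dot (X *m v) w = dot v (mstar X *m w).
Proof.
rewrite /dot; under eq_bigr do rewrite mxE star_sum mulr_suml.
rewrite exchange_big; apply: eq_bigr => j _; rewrite !mxE mulr_sumr.
by apply: eq_bigr => i _; rewrite mxE starM mulrA.
Qed.

(** Columns form a right module for [dot], whereas [*:] multiplies on the left. *)
Definition rscale v a : 'cV[D]_n := \col_i (v i 0 * a).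

Lemma dot_rscaler v w a : dot v (rscale w a) = dot v w * a.
Proof.
by rewrite /dot mulr_suml; apply: eq_bigr => i _; rewrite mxE mulrA.
Qed.

Lemma dot_rscalel v w a : dot (rscale v a) w = star a * dot v w.
Proof.
by rewrite /dot mulr_sumr; apply: eq_bigr => i _; rewrite mxE starM mulrA.
Qed.

Lemma pos_dot v : pos (dot v v).
Proof. by apply: pos_sum => i _; exact: pos_starM. Qed.

Lemma nrm_entry_dot v i : nrm (v i 0) ^+ 2 <= nrm (dot v v).
Proof.
rewrite -nrm_starM; apply: pos_nrm_mono; first exact: pos_starM.
rewrite /dot (bigD1 i) //= addrC addrK.
by apply: pos_sum => j _; exact: pos_starM.
Qed.

(** Expand [dot u u], which is positive, for [u = v a - w t]. As [dot v v] is at most [t], this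
    bounds [star a * a] by [rs t * dot w w]. *)
Lemma dot_cauchy_schwarz v w :
  nrm (dot v w) ^+ 2 <= nrm (dot v v) * nrm (dot w w).
Proof.
set a := dot v w; set t := nrm (dot v v).
(* If [t = 0], all entries of [v] vanish; otherwise [t] can be cancelled at the end. *)
have [t0|t0] := eqVneq t 0.
  suff -> : a = 0 by rewrite nrm0 expr0n mulr_ge0 ?nrm_ge0.
  rewrite /a /dot big1 // => i _.
  suff -> : v i 0 = 0 by rewrite star0 mul0r.
  apply: nrm_eq0; apply/eqP; rewrite -sqrf_eq0 eq_le sqr_ge0 andbT.
  by rewrite -t0 nrm_entry_dot.
have tp : 0 < t by rewrite lt_def t0 nrm_ge0.
pose u := rscale v a + rscale w (- rs t).
have uu : dot u u + star a * (rs t - dot v v) * a =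
    rs t * (rs t * dot w w - star a * a).
  rewrite dotDl !dotDr !dot_rscaler !dot_rscalel -(star_dot v w) -/a.
  rewrite starN star_rs !mulrN !mulNr -[star a * a * rs t]rsC.
  rewrite -[rs t * dot w w * rs t]rsC mulrBr mulrBl -[star a * rs t]rsC.
  ncring.
have : pos (rs t * (rs t * dot w w - star a * a)).
  rewrite -uu; apply: posD; first exact: pos_dot.
  have [z sz ->] := pos_rsB (ltW tp) (pos_star (pos_dot v)) (lexx _).
  by rewrite mulrA -mulrA -{1}sz -starM; exact: pos_starM.
have ti : 0 <= t^-1 by rewrite invr_ge0 ltW.
move=> /(pos_rs ti); rewrite rsK // => h.
rewrite -nrm_starM; have := pos_nrm_mono (pos_starM a) h.
by rewrite nrm_rs // ltW.
Qed.

Definition cvnrm v : R := Num.sqrt (nrm (dot v v)).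

Lemma cvnrm_ge0 v : 0 <= cvnrm v.
Proof. exact: sqrtr_ge0. Qed.

Lemma cvnrm_sqr v : cvnrm v ^+ 2 = nrm (dot v v).
Proof. by rewrite sqr_sqrtr ?nrm_ge0. Qed.

Lemma nrm_dot v w : nrm (dot v w) <= cvnrm v * cvnrm w.
Proof.
rewrite -(ler_pXn2r (n := 2)) ?nnegrE ?mulr_ge0 ?cvnrm_ge0 ?nrm_ge0 //.
by rewrite exprMn !cvnrm_sqr dot_cauchy_schwarz.
Qed.

Lemma nrm_entry v i : nrm (v i 0) <= cvnrm v.
Proof.
rewrite -(ler_pXn2r (n := 2)) ?nnegrE ?cvnrm_ge0 ?nrm_ge0 //.
by rewrite cvnrm_sqr nrm_entry_dot.
Qed.

Lemma cvnrmD v w : cvnrm (v + w) <= cvnrm v + cvnrm w.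
Proof.
rewrite -(ler_pXn2r (n := 2)) ?nnegrE ?addr_ge0 ?cvnrm_ge0 //.
rewrite cvnrm_sqr dotDl !dotDr.
have := nrm_dot v w; have := nrm_dot w v; have := nrm_dot v v; have := nrm_dot w w.
have := nrmD (dot v v + dot v w) (dot w v + dot w w).
have := nrmD (dot v v) (dot v w); have := nrmD (dot w v) (dot w w).
by nra.
Qed.

Lemma cvnrm_le_sum v : cvnrm v <= \sum_i nrm (v i 0).
Proof.
have s0 : 0 <= \sum_i nrm (v i 0) by apply: sumr_ge0 => i _; exact: nrm_ge0.
rewrite -(ler_pXn2r (n := 2)) ?nnegrE ?cvnrm_ge0 //.
rewrite cvnrm_sqr /dot expr2 mulr_suml.
apply: (big_ind2 (fun x (y : R) => nrm x <= y)) => [|x1 x2 y1 y2 h1 h2|i _].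
- by rewrite nrm0.
- by rewrite (le_trans (nrmD _ _)) // lerD.
rewrite nrm_starM expr2 ler_wpM2l ?nrm_ge0 // (bigD1 i) //= lerDl.
by apply: sumr_ge0 => j _; exact: nrm_ge0.
Qed.

Lemma nrm_sum (I : Type) (r : seq I) (P : pred I) (F : I -> D) :
  nrm (\sum_(i <- r | P i) F i) <= \sum_(i <- r | P i) nrm (F i).
Proof.
apply: (big_ind2 (fun x (y : R) => nrm x <= y)) => [|x1 x2 y1 y2 h1 h2|//].
- by rewrite nrm0.
by rewrite (le_trans (nrmD _ _)) // lerD.
Qed.

Lemma mulmx_cvnrm X v :
  cvnrm (X *m v) <= (\sum_i \sum_j nrm (X i j)) * cvnrm v.
Proof.
rewrite (le_trans (cvnrm_le_sum _)) // mulr_suml; apply: ler_sum => i _.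
rewrite mxE (le_trans (nrm_sum _ _ _)) // mulr_suml; apply: ler_sum => j _.
by rewrite (le_trans (nrmM _ _)) // ler_wpM2l ?nrm_ge0 ?nrm_entry.
Qed.

Lemma sum_nrm_ge0 X : 0 <= \sum_i \sum_j nrm (X i j).
Proof. by do 2![apply: sumr_ge0 => ? _]; exact: nrm_ge0. Qed.

Lemma mulmx_bounded X : opbound cvnrm (mulmx (p := 1)) X !=set0.
Proof.
by exists (\sum_i \sum_j nrm (X i j)); split;
  [exact: sum_nrm_ge0|exact: mulmx_cvnrm].
Qed.

Definition mnrm : M -> R := opn cvnrm (mulmx (p := 1)).

Lemma mnrm_le X : mnrm X <= \sum_i \sum_j nrm (X i j).
Proof. by apply: opn_le; [exact: sum_nrm_ge0|exact: mulmx_cvnrm]. Qed.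

(** Test on a basis column. With [mnrm_le], convergence of matrices is entrywise, whence
    completeness. *)
Lemma nrm_le_mnrm X i j : nrm (X i j) <= mnrm X.
Proof.
have := opn_bound cvnrm_ge0 mulmx_bounded X (delta_mx j 0).
set e := delta_mx j 0.
have e1 : cvnrm e <= 1.
  rewrite -(ler_pXn2r (n := 2)) ?nnegrE ?cvnrm_ge0 // cvnrm_sqr expr1n.
  rewrite /dot (bigD1 j) //= big1 => [|k kj].
    by rewrite !mxE !eqxx addr0 mulr1 star1 nrm1_le.
  by rewrite !mxE (negbTE kj) mulr0.
have -> : X i j = (X *m e) i 0.
  by rewrite -colE mxE.
move=> h; apply: (le_trans (nrm_entry _ i)); apply: (le_trans h).
rewrite ler_piMr //; exact: opn_ge0 mulmx_bounded _.
Qed.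

Definition mscal k : M := (scal k)%:M.

Let mscalD : {morph mscal : k l / k + l}.
Proof. by move=> k l; rewrite /mscal scalD raddfD. Qed.

Let mscalM : {morph mscal : k l / k * l}.
Proof. by move=> k l; rewrite /mscal scalM scalar_mxM. Qed.

Let mscal1 : mscal 1 = 1.
Proof. by rewrite /mscal scal1. Qed.

Lemma mscalE k X : mscal k * X = \matrix_(i, j) (scal k * X i j).
Proof. by rewrite /mscal -mulmxE mul_scalar_mx; apply/matrixP => i j; rewrite !mxE. Qed.

Let mscalC k X : mscal k * X = X * mscal k.
Proof.
rewrite mscalE; apply/matrixP => i j; rewrite -mulmxE !mxE (bigD1 j) //= big1 => [|l lj].
  by rewrite !mxE eqxx mulr1n addr0 scalC.
by rewrite !mxE (negbTE lj) mulr0n mulr0.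
Qed.

Let mstarK : involutive mstar.
Proof. by move=> X; apply/matrixP => i j; rewrite !mxE starK. Qed.

Let mstarD : {morph mstar : X Y / X + Y}.
Proof. by move=> X Y; apply/matrixP => i j; rewrite !mxE starD. Qed.

Let mstarM X Y : mstar (X * Y) = mstar Y * mstar X.
Proof.
apply/matrixP => i j; rewrite -!mulmxE !mxE star_sum; apply: eq_bigr => k _.
by rewrite !mxE starM.
Qed.

Let mstar_scal k : mstar (mscal k) = mscal (Num.conj k).
Proof.
apply/matrixP => i j; rewrite !mxE [j == i]eq_sym.
by case: eqP => _; rewrite ?mulr1n ?mulr0n ?star0 ?star_scal.
Qed.

Let mnrm_ge0 X : 0 <= mnrm X.
Proof. exact: opn_ge0 mulmx_bounded _. Qed.

Let mnrm_eq0 X : mnrm X = 0 -> X = 0.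
Proof.
move=> X0; apply/matrixP => i j; rewrite mxE; apply: nrm_eq0; apply/eqP.
by rewrite eq_le nrm_ge0 andbT -X0 nrm_le_mnrm.
Qed.

Let mnrmD X Y : mnrm (X + Y) <= mnrm X + mnrm Y.
Proof.
apply: opnD => [||v]; [exact: cvnrm_ge0|exact: mulmx_bounded|].
by rewrite mulmxDl cvnrmD.
Qed.

Let mnrmM X Y : mnrm (X * Y) <= mnrm X * mnrm Y.
Proof.
apply: opnM => [||v]; [exact: cvnrm_ge0|exact: mulmx_bounded|].
by rewrite -mulmxE mulmxA.
Qed.

Let mnrm_scal k X : mnrm (mscal k * X) <= cabs k * mnrm X.
Proof.
apply: opn_le => [|v]; first by rewrite mulr_ge0 ?cabs_ge0.
rewrite -mulrA; apply: (@le_trans _ _ (cabs k * cvnrm (X *m v))); last first.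
  rewrite ler_wpM2l ?cabs_ge0 //.
  exact: opn_bound cvnrm_ge0 mulmx_bounded _ _.
rewrite -(ler_pXn2r (n := 2)) ?nnegrE ?mulr_ge0 ?cabs_ge0 ?cvnrm_ge0 //.
have -> : mscal k * X *m v = scal k *: (X *m v).
  by rewrite /mscal -mulmxE mul_scalar_mx scalemxAl.
move: (X *m v) => w; rewrite exprMn !cvnrm_sqr.
have -> : dot (scal k *: w) (scal k *: w) = scal (Num.conj k) * (scal k * dot w w).
  rewrite /dot !mulr_sumr; apply: eq_bigr => i _.
  rewrite !mxE starM star_scal -[star _ * scal _]scalC -!mulrA; congr (_ * _).
  by rewrite !mulrA -[star _ * scal _]scalC.
rewrite (le_trans (nrm_scal _ _)) // cabs_conj expr2 -mulrA ler_wpM2l ?cabs_ge0 //.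
exact: nrm_scal.
Qed.

Let mnrm_sqr_le X : mnrm X ^+ 2 <= mnrm (mstar X * X).
Proof.
apply: opn_sqr_le => [||v]; [exact: cvnrm_ge0|exact: mulmx_bounded|].
by rewrite cvnrm_sqr dot_adj mulmxA; exact: nrm_dot.
Qed.

Lemma tends_matrix (u : nat -> M) X :
  (forall i j, tends (fun m => u m i j) (X i j)) ->
  (fun m => mnrm (u m - X)) @ \oo --> (0 : R).
Proof.
move=> uX; pose b m := \sum_i \sum_j nrm (u m i j - X i j).
have b0 : b @ \oo --> (0 : R).
  rewrite [X in _ --> X](_ : 0 = \sum_(i < n) \sum_(j < n) 0); last first.
    by rewrite big1 // => i _; rewrite big1.
  by do 2![apply: cvg_big => [|? _]; first exact: add_continuous]; exact: uX.
apply: (squeeze_cvgr _ (cvg_cst (0:R)) b0); apply: nearW => m.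
rewrite mnrm_ge0 (le_trans (mnrm_le _)) // /b.
by do 2![apply: ler_sum => ? _]; rewrite !mxE.
Qed.

Let mnrm_complete (u : nat -> M) :
  (forall e : R, 0 < e -> exists N, forall p q, (N <= p)%N -> (N <= q)%N ->
     mnrm (u p - u q) < e) ->
  exists X, (fun m => mnrm (u m - X)) @ \oo --> (0 : R).
Proof.
move=> uc; exists (\matrix_(i, j) slim (fun m => u m i j)).
apply: tends_matrix => i j; rewrite mxE.
apply: (@xgetPex D 0 [set l | tends (fun m => u m i j) l]).
apply: nrm_complete => e /uc[N hN]; exists N => p q Np Nq.
by apply: le_lt_trans (hN p q Np Nq); have := nrm_le_mnrm (u p - u q) i j; rewrite !mxE.
Qed.

HB.instance Definition _ := isUnitalCStar.Build R M
  mscalD mscalM mscal1 mscalC mstarK mstarD mstarM mstar_scal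
  mnrm_ge0 mnrm_eq0 mnrmD mnrmM mnrm_scal mnrm_sqr_le mnrm_complete.

End MatrixAlgebra.

(** * Positivity in a C*-algebra through its unitization *)

Section Embedding.
Variables (R : realType) (C : cstarAlgType R).
Local Notation D := (unitization C).
Implicit Types (a b y z : C) (k : R[i]).

Definition uinj a : D := (a, 0).

Lemma uinjD : {morph uinj : a b / a + b}.
Proof. by move=> a b; apply: unitization_eq; rewrite /= ?addr0. Qed.
Lemma uinj0 : uinj 0 = 0.
Proof. by []. Qed.
Lemma uinjN a : uinj (- a) = - uinj a.
Proof. by apply: unitization_eq; rewrite /= ?oppr0. Qed.
Lemma uinjB a b : uinj (a - b) = uinj a - uinj b.
Proof. by rewrite uinjD uinjN. Qed.
Lemma uinjM a b : uinj (cmul a b) = uinj a * uinj b.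
Proof. by apply: unitization_eq; rewrite /= ?mulr0 // !scale0r !addr0. Qed.
Lemma uinjZ k a : uinj (k *: a) = scal k * uinj a.
Proof.
by apply: unitization_eq; rewrite /= ?mulr0 // cmul0r scaler0 addr0 add0r.
Qed.
Lemma uinj_star a : uinj (cstar a) = star (uinj a).
Proof. by apply: unitization_eq; rewrite //= rmorph0. Qed.
Lemma uinj_sum (I : Type) (r : seq I) (P : pred I) (F : I -> C) :
  uinj (\sum_(i <- r | P i) F i) = \sum_(i <- r | P i) uinj (F i).
Proof. exact: (big_morph _ uinjD uinj0). Qed.
Lemma uinj_inj : injective uinj.
Proof. by move=> a b []. Qed.
Lemma uinjP (x : D) : x.2 = 0 -> x = uinj x.1.
Proof. by move=> x2; apply: unitization_eq. Qed.

Lemma snd_sum (I : Type) (r : seq I) (P : pred I) (F : I -> D) :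
  (\sum_(i <- r | P i) F i).2 = \sum_(i <- r | P i) (F i).2.
Proof. exact: (big_morph (fun x : D => x.2) (fun _ _ => erefl) erefl). Qed.

Lemma fst_sum (I : Type) (r : seq I) (P : pred I) (F : I -> D) :
  (\sum_(i <- r | P i) F i).1 = \sum_(i <- r | P i) (F i).1.
Proof. exact: (big_morph (fun x : D => x.1) (fun _ _ => erefl) erefl). Qed.

Lemma cpos_uinj a : cpos a -> pos (uinj a).
Proof. by move=> [b ->]; rewrite uinjM uinj_star; exact: pos_starM. Qed.

(** The scalar component of the root taken in the unitization has square 0, so the root lies in
    [C]. *)
Lemma uinj_cpos a : pos (uinj a) -> exists z,
  [/\ cstar z = z, cmul z z = a & forall y, cmul y a = cmul a y -> cmul y z = cmul z y].
Proof.
move=> /pos_sqrt[x [sx xx xc]].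
have x2 : x.2 = 0.
  have /(congr1 (fun w : D => w.2)) /= /eqP := xx.
  by rewrite mulf_eq0 orbb => /eqP.
move: sx xx xc; rewrite (uinjP x2) -uinj_star -uinjM => /uinj_inj sx /uinj_inj xx xc.
exists x.1; split=> // y ya.
by apply: uinj_inj; rewrite !uinjM; apply: xc; rewrite -!uinjM ya.
Qed.

Lemma cposP a : cpos a <-> pos (uinj a).
Proof.
split; first exact: cpos_uinj.
by move=> /uinj_cpos[z [sz zz _]]; exists z; rewrite sz.
Qed.

Lemma cpos_sqrt a : cpos a -> exists z,
  [/\ cstar z = z, cmul z z = a & forall y, cmul y a = cmul a y -> cmul y z = cmul z y].
Proof. by move=> /cpos_uinj/uinj_cpos. Qed.

Lemma cpos_starM a : cpos (cmul (cstar a) a).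
Proof. by exists a. Qed.

Lemma cpos_Mstar a : cpos (cmul a (cstar a)).
Proof. by exists (cstar a); rewrite cstarK. Qed.

Lemma cpos_star a : cpos a -> cstar a = a.
Proof. by move=> [b ->]; rewrite cstarM cstarK. Qed.

Lemma cpos_sum (I : Type) (r : seq I) (P : pred I) (F : I -> C) :
  (forall i, P i -> cpos (F i)) -> cpos (\sum_(i <- r | P i) F i).
Proof.
by move=> pF; apply/cposP; rewrite uinj_sum; apply: pos_sum => i /pF/cposP.
Qed.

Lemma cpos_antisym a : cpos a -> cpos (- a) -> a = 0.
Proof.
by move=> /cposP pa /cposP; rewrite uinjN => pna; apply: uinj_inj; exact: pos_antisym.
Qed.

Lemma cposZ (t : R) a : 0 <= t -> cpos a -> cpos (t%:C *: a).
Proof. by move=> t0 /cposP pa; apply/cposP; rewrite uinjZ; exact: pos_rs. Qed.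

(** The root [w] of [b] commutes with [a], hence [w z z w = w a w = a b]. *)
Lemma cpos_cmul a b : cpos a -> cpos b -> cmul a b = cmul b a -> cpos (cmul a b).
Proof.
move=> /cpos_sqrt[z [sz zz zc]] /cpos_sqrt[w [sw ww wc]] ab.
exists (cmul z w); rewrite cstarM sz sw.
have aw : cmul a w = cmul w a by exact: wc.
by rewrite -cmulA [cmul z (cmul z w)]cmulA zz aw cmulA ww ab.
Qed.

End Embedding.

(** * Positive matrices through the unitization *)

Section MatrixEmbedding.
Variables (R : realType) (C : cstarAlgType R) (n : nat).
Implicit Types (X Y : 'M[C]_n) (Z : 'M[unitization C]_n).

Definition minj X : 'M[unitization C]_n := map_mx (@uinj R C) X.

Lemma minjM X Y : minj (mxcmul X Y) = minj X * minj Y.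
Proof.
apply/matrixP => i j; rewrite -mulmxE !mxE uinj_sum; apply: eq_bigr => k _.
by rewrite !mxE uinjM.
Qed.

Lemma minj_star X : minj (mxcstar X) = star (minj X).
Proof. by apply/matrixP => i j; rewrite !mxE uinj_star. Qed.

(* A self-adjoint complex matrix of square zero vanishes. *)
Lemma snd_sqr_eq0 Z : star Z = Z -> (forall i j, ((Z * Z) i j).2 = 0) ->
  forall i j, (Z i j).2 = 0.
Proof.
move=> sZ ZZ i j.
have /eqP := ZZ i i; rewrite -mulmxE mxE snd_sum.
have e k : (Z i k * Z k i).2 = (Z i k).2 * Num.conj (Z i k).2.
  by have -> : Z k i = star (Z i k) by rewrite -[in LHS]sZ mxE.
under eq_bigr do rewrite e.
rewrite psumr_eq0 => [/allP/(_ j)|k _]; last exact: mul_conjC_ge0.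
by rewrite mem_index_enum => /(_ isT); rewrite mul_conjC_eq0 => /eqP.
Qed.

Lemma minj_mxcpos X : pos (minj X) -> mxcpos X.
Proof.
move=> [Z sZ XZ].
have Z2 : forall i j, (Z i j).2 = 0.
  by apply: snd_sqr_eq0 => // i j; rewrite -XZ mxE.
pose Y : 'M[C]_n := map_mx (fun x : unitization C => x.1) Z.
have ZY : Z = minj Y by apply/matrixP => i j; rewrite !mxE -uinjP.
exists Y; apply/matrixP => i j; apply: uinj_inj.
have /matrixP/(_ i j) : minj X = minj (mxcmul (mxcstar Y) Y).
  by rewrite minjM minj_star -ZY sZ.
by rewrite !mxE.
Qed.

End MatrixEmbedding.

(** * Entanglement breaking maps are PPT *)

Section OppositeMap.
Variables (R : realType) (A : cstarAlgType R).

Definition to_op (a : A) : opposite A := a.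

Lemma to_op_is_linear : linear to_op.
Proof. by []. Qed.

HB.instance Definition _ :=
  GRing.isLinear.Build R[i] A (opposite A) *:%R to_op to_op_is_linear.

Lemma to_op_positive : positive_map to_op.
Proof.
move=> a /cpos_sqrt[z [sz zz _]]; exists (z : opposite A).
by rewrite /to_op -zz -[in LHS]sz {1}sz.
Qed.

End OppositeMap.

Lemma entanglement_breaking_ppt (R : realType) (A B : cstarAlgType R)
    (T : A -> B) : entanglement_breaking T -> ppt T.
Proof.
move=> ebT; split; first exact: (ebT B idfun).
by apply: (ebT (opposite B) (@to_op R B)); exact: to_op_positive.
Qed.

(** * Complete positivity into the opposite algebra *)

Section SelfOpposite.
Variables (R : realType) (A : cstarAlgType R) (e : A) (T : A -> A).
Hypotheses (e1 : forall a, cmul e a = a) (e2 : forall a, cmul a e = a).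
Hypothesis se : cstar e = e.

(* Complete positivity of [T] into the opposite algebra, applied to the positive
   matrix [[e, a], [a^*, a^* a]] of fixed points of [T]. *)
Lemma cp_op_normal a : completely_positive (T : A -> opposite A) ->
  T e = e -> T a = a -> T (cstar a) = cstar a ->
  T (cmul (cstar a) a) = cmul (cstar a) a ->
  cpos (cmul (cstar a) a - cmul a (cstar a)).
Proof.
move=> cpT Te Ta Tsa Tsaa.
pose y (j : 'I_2) := if j == 0 then e else a.
pose Y : 'M[A]_2 := \matrix_(i, j) if i == 0 then y j else 0.
have yy i j : mxcmul (mxcstar Y) Y i j = cmul (cstar (y i)) (y j).
  by rewrite !mxE big_ord_recl big_ord1 !mxE /= cstar0 cmul0r addr0.
have [|Z ZE] := cpT 2 (mxcmul (mxcstar Y) Y); first by exists Y.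
(* Products are reversed: a positive matrix over the opposite algebra has these entries in [A]. *)
have zz i j : T (cmul (cstar (y i)) (y j)) = \sum_k cmul (Z k j : A) (cstar (Z k i : A)).
  have /matrixP/(_ i j) := ZE; rewrite mxE yy => ->; rewrite mxE.
  by apply: eq_bigr => k _; rewrite mxE.
have h11 := zz 0 0; have h12 := zz 0 1; have h21 := zz 1 0; have h22 := zz 1 1.
rewrite /y /= ?se ?e1 ?e2 ?Te ?Ta ?Tsa ?Tsaa in h11 h12 h21 h22.
(* This compresses the matrix by the row with entries [- a] and [e]: with [a'] the adjoint of [a],
   the sum is [a' a - a a' - a a' + a a']. *)
pose w k : A := (Z k 1 : A) - cmul a (Z k 0 : A).
suff -> : cmul (cstar a) a - cmul a (cstar a) = \sum_k cmul (w k) (cstar (w k)).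
  by apply: cpos_sum => k _; exact: cpos_Mstar.
transitivity (\sum_k (cmul (Z k 1 : A) (cstar (Z k 1 : A))
    - cmul (cmul (Z k 1 : A) (cstar (Z k 0 : A))) (cstar a)
    - cmul a (cmul (Z k 0 : A) (cstar (Z k 1 : A)))
    + cmul a (cmul (cmul (Z k 0 : A) (cstar (Z k 0 : A))) (cstar a)))).
  rewrite big_split !sumrB /= -!cmul_sumr -!cmul_suml -h11 -h12 -h21 -h22 e1.
  by rewrite addrNK.
apply: eq_bigr => k _; rewrite /w cstarB cstarM !cmulBl !cmulBr !cmulA.
by rewrite opprB addrA addrAC.
Qed.

End SelfOpposite.

(** * Unital positive maps are star-preserving and bounded *)

Section UnitalPositivity.
Variables (R : realType) (A : cstarAlgType R) (e : A).
Hypotheses (cmul1r : left_id e cmul) (cmulr1 : right_id e cmul).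
Implicit Types (x y a b : A) (t : R).

Lemma cstar1 : cstar e = e.
Proof.
have : cstar (cmul (cstar e) e) = cmul (cstar e) e by rewrite cstarM cstarK.
by rewrite cmulr1 cstarK.
Qed.

Lemma cpos1 : cpos e.
Proof. by exists e; rewrite cstar1 cmul1r. Qed.

(** The unit [e] of [A] is not that of the unitization. There [rs t - x] is positive, and
    compression by [e] turns it into [t e - x]. *)
Lemma cpos_unitB t x : 0 <= t -> cstar x = x -> cn x <= t -> cpos (t%:C *: e - x).
Proof.
move=> t0 sx xt; apply/cposP.
have [|||z sz zz] := @pos_rsB R (unitization A) t (uinj x) => //.
- by rewrite -uinj_star sx.
- by apply: le_trans (unrm_le _) _; rewrite /= cabs0 addr0.
have eC y : uinj e * uinj y = uinj y * uinj e by rewrite -!uinjM cmul1r cmulr1.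
have ee : uinj e * uinj e = uinj e by rewrite -uinjM cmul1r.
have -> : uinj (t%:C *: e - x) = star (z * uinj e) * (z * uinj e).
  rewrite starM sz -uinj_star cstar1 -mulrA [z * (z * _)]mulrA -zz.
  rewrite mulrBl mulrBr uinjB uinjZ -/(rs t) mulrA -[uinj e * rs t]rsC -mulrA ee.
  by rewrite -!uinjM cmulr1 cmul1r.
exact: pos_starM.
Qed.

Variable E : {linear A -> A}.
Hypotheses (Epos : positive_map E) (E1 : E e = e).

(** [x] is a real multiple of [e] minus a positive element, and positive elements are
    self-adjoint. *)
Lemma positive_sa x : cstar x = x -> cstar (E x) = E x.
Proof.
move=> sx; have := cpos_star (Epos (cpos_unitB (cn_ge0 x) sx (lexx _))).
rewrite linearB linearZ /= E1 cstarB cstarZ cstar1 conj_Creal ?complex_real //.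
by move=> /addrI/oppr_inj.
Qed.

Lemma cartesian x : exists u v, [/\ cstar u = u, cstar v = v,
  x = u + 'i%R *: v, cn u <= cn x & cn v <= cn x].
Proof.
exists (2^-1 *: (x + cstar x)), ((2^-1 * 'i%R) *: (cstar x - x)).
have h2 : Num.conj (2^-1 : R[i]) = 2^-1 by rewrite conj_Creal // realV realn.
have c2 : cabs (2^-1 : R[i]) = 2^-1.
  by rewrite -(@cabs_real R 2^-1) ?invr_ge0 // fmorphV rmorph_nat.
split.
- by rewrite cstarZ cstarD cstarK h2 addrC.
- by rewrite cstarZ rmorphM /= conjCi cstarB cstarK h2 mulrN scaleNr -scalerN opprB.
- rewrite scalerA mulrCA -expr2 sqrCi mulrN1 scaleNr -scalerN opprB -scalerDr.
  rewrite addrACA subrr addr0 (_ : x + x = 2 *: x); last by rewrite scaler_nat.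
  by rewrite scalerA mulVf ?scale1r // pnatr_eq0.
- rewrite cnZ c2 ler_pdivrMl // mulr_natl mulr2n (le_trans (cnD _ _)) //.
  by rewrite cn_star.
- rewrite cnZ cabsM c2 cabsi mulr1 ler_pdivrMl // mulr_natl mulr2n.
  by rewrite (le_trans (cnD _ _)) // cn_star cnN.
Qed.

Lemma positive_star x : E (cstar x) = cstar (E x).
Proof.
have [u [v [su sv -> _ _]]] := cartesian x.
rewrite cstarD cstarZ su sv !linearD !linearZ /= cstarD cstarZ.
by rewrite !positive_sa.
Qed.

(** [t e - E x] lies between 0 and [2 t e], so its norm is at most [2 t]; adding [t e] back costs
    another [t]. *)
Lemma positive_sa_le x : cstar x = x -> nrm (uinj (E x)) <= 3 * cn x.
Proof.
move=> sx; set t := cn x; have t0 : 0 <= t := cn_ge0 x.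
have p1 : pos (uinj (t%:C *: e - E x)).
  have <- : E (t%:C *: e - x) = t%:C *: e - E x by rewrite linearB linearZ /= E1.
  by apply/cposP/Epos/cpos_unitB.
have p2 : pos (uinj (t%:C *: e + E x)).
  have <- : E (t%:C *: e - - x) = t%:C *: e + E x.
    by rewrite opprK linearD linearZ /= E1.
  by apply/cposP/Epos/cpos_unitB; rewrite ?cstarN ?sx ?cnN.
have h : nrm (uinj (t%:C *: e)) <= t.
  rewrite uinjZ nrm_rs // ler_piMr //.
  have := nrm_starM (uinj e); rewrite -uinj_star cstar1 -uinjM cmul1r => h.
  by have := nrm_ge0 (uinj e); nra.
have := @pos_nrm_mono _ _ _ (uinj (t%:C *: e) + uinj (t%:C *: e)) p1.
rewrite -uinjD -uinjB opprB [E x - _]addrC addrA addrK => /(_ p2).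
have := nrmB (uinj (t%:C *: e)) (uinj (t%:C *: e - E x)).
rewrite -uinjB opprB addrCA subrr addr0.
have := nrmD (uinj (t%:C *: e)) (uinj (t%:C *: e)); rewrite -uinjD.
by lra.
Qed.

(** The constant is 3 for a self-adjoint element, twice for the two parts of [x], and a factor 2
    from [cn_unrm]. *)
Lemma positive_bounded x : cn (E x) <= 12 * cn x.
Proof.
have [u [v [su sv xe ux vx]]] := cartesian x.
have h1 := positive_sa_le su; have h2 := positive_sa_le sv.
have h3 : nrm (uinj (E x)) <= nrm (uinj (E u)) + nrm (uinj (E v)).
  rewrite xe linearD linearZ /= uinjD uinjZ (le_trans (nrmD _ _)) //.
  by rewrite lerD2l nrm_im.
have := cn_unrm (uinj (E x)); rewrite -[unrm _]/(nrm _) [(uinj _).1]/=.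
by lra.
Qed.

Lemma fixed_closed (u : nat -> A) l : (forall n, E (u n) = u n) ->
  (fun n => cn (u n - l)) @ \oo --> (0 : R) -> E l = l.
Proof.
move=> Eu ul; apply/eqP; rewrite -subr_eq0; apply/eqP/cn_eq0/eqP.
rewrite eq_le cn_ge0 andbT.
(* Here 13 is [1 + 12], for the two terms of [E l - l = (u n - l) - E (u n - l)]. *)
have h : (fun n => 13 * cn (u n - l)) @ \oo --> (0 : R).
  by have := cvgM (cvg_cst (13 : R)) ul; rewrite mulr0; exact.
apply: (cvgr_to_ge h); apply: nearW => n.
have -> : E l - l = (u n - l) - E (u n - l).
  by rewrite linearB Eu opprB [RHS]addrC addrA subrK.
rewrite (le_trans (cnD _ _)) // cnN.
by have := positive_bounded (u n - l); lra.
Qed.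

End UnitalPositivity.

(** * Square roots of matrices over the range of a conditional expectation *)

Section ConditionalExpectation.
Variables (R : realType) (A : cstarAlgType R) (e : A).
Hypotheses (cmul1r : left_id e cmul) (cmulr1 : right_id e cmul).
Variable E : {linear A -> A}.
Hypotheses (Epos : positive_map E) (E1 : E e = e).
Hypothesis Eidem : forall x, E (E x) = E x.
Hypothesis Ebimod : forall a x b, E a = a -> E b = b ->
  E (cmul (cmul a x) b) = cmul (cmul a (E x)) b.
Local Notation D := (unitization A).

Let Estar x : E (cstar x) = cstar (E x).
Proof. exact: positive_star cmul1r cmulr1 E Epos E1 x. Qed.

Lemma fixedM a b : E a = a -> E b = b -> E (cmul a b) = cmul a b.
Proof.
move=> Ea Eb; have := Ebimod e Ea Eb.
by rewrite E1 cmulr1.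
Qed.

Variable n : nat.
Implicit Types (X Y : 'M[A]_n) (Z W : 'M[D]_n).

(** Scalar components are left free, so that the set contains the scalars of the matrix algebra and
    [csqrt_closed] applies. *)
Definition fixed_mx : set 'M[D]_n := [set Z | forall i j, E (Z i j).1 = (Z i j).1].

Lemma fixed_mxD Z W : fixed_mx Z -> fixed_mx W -> fixed_mx (Z + W).
Proof. by move=> fZ fW i j; rewrite !mxE linearD fZ fW. Qed.

Lemma fixed_mxN Z : fixed_mx Z -> fixed_mx (- Z).
Proof. by move=> fZ i j; rewrite mxE linearN fZ. Qed.

Lemma fixed_mxM Z W : fixed_mx Z -> fixed_mx W -> fixed_mx (Z * W).
Proof.
move=> fZ fW i j; rewrite -mulmxE mxE fst_sum linear_sum; apply: eq_bigr => k _ /=.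
by rewrite !linearD !linearZ /= fixedM ?fZ ?fW.
Qed.

Lemma fixed_mx_rs t : fixed_mx (rs t).
Proof.
move=> i j; rewrite !mxE; case: eqP => _; rewrite ?mulr0n ?mulr1n /=; exact: linear0.
Qed.

Lemma fixed_mx_closed (u : nat -> 'M[D]_n) Z :
  (forall m, fixed_mx (u m)) -> tends u Z -> fixed_mx Z.
Proof.
move=> fu uZ i j; apply: (@fixed_closed _ _ e cmul1r cmulr1 E Epos E1
  (fun m => (u m i j).1)).
  by move=> m; exact: fu.
have h : (fun m => 2 * nrm (u m - Z)) @ \oo --> (0 : R).
  by have := cvgM (cvg_cst (2 : R)) uZ; rewrite mulr0; exact.
apply: (squeeze_cvgr _ (cvg_cst (0:R)) h); apply: nearW => m; rewrite cn_ge0 /=.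
have := cn_unrm ((u m - Z) i j); rewrite !mxE => /le_trans; apply.
rewrite ler_wpM2l //.
by have := nrm_le_mnrm (u m - Z) i j; rewrite !mxE.
Qed.

Lemma fixed_mx_csqrt Z : nrm (1 - Z) <= 1 -> fixed_mx Z -> fixed_mx (csqrt Z).
Proof.
by move=> Z1; apply: csqrt_closed => //; [exact: fixed_mxD|exact: fixed_mxM|
  exact: fixed_mx_rs|exact: fixed_mx_closed].
Qed.

Lemma mxcmulE_fixed X Y : (forall i j, E (Y i j) = Y i j) ->
  mxcmul (mxcmul (mxcstar Y) (map_mx E X)) Y =
  map_mx E (mxcmul (mxcmul (mxcstar Y) X) Y).
Proof.
move=> fY; apply/matrixP => i j; rewrite !mxE linear_sum; apply: eq_bigr => k _ /=.
rewrite !mxE !cmul_suml linear_sum; apply: eq_bigr => l _ /=.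
by rewrite !mxE Ebimod // Estar fY.
Qed.

(* The negative part [m] of [G] has its entries in the range of [E], so that
   [m G m = E (m X m)] has a positive diagonal. *)
Lemma cond_exp_square X : mxcpos X -> exists Y : 'M[A]_n,
  (forall i j, E (Y i j) = Y i j) /\ map_mx E X = mxcmul (mxcstar Y) Y.
Proof.
move=> [Y0 XY].
have sX : mxcstar X = X.
  apply/matrixP => i j; rewrite XY !mxE cstar_sum; apply: eq_bigr => k _.
  by rewrite !mxE cstarM cstarK.
pose F := minj (map_mx E X).
have sF : star F = F.
  apply/matrixP => i j; rewrite !mxE -uinj_star -Estar.
  by rewrite -[in RHS]sX mxE.
have fF : fixed_mx F by move=> i j; rewrite !mxE /= Eidem.
(* Scaling by [t] makes [G] a contraction, as [cabsv] and [cneg] require. *)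
pose t := nrm F + 1.
have t0 : 0 < t by have := nrm_ge0 F; rewrite /t; lra.
have tn0 : t != 0 by rewrite lt0r_neq0.
pose G := rs t^-1 * F.
have sG : star G = G by rewrite starM star_rs sF -rsC.
have fG : fixed_mx G by apply: fixed_mxM => //; exact: fixed_mx_rs.
have G1 : nrm G <= 1.
  rewrite nrm_rs ?invr_ge0 ?(ltW t0) // ler_pdivrMl // mulr1 /t.
  by rewrite lerDl.
have G2 i j : (G i j).2 = 0.
  by rewrite /G /rs [_ * _]mscalE !mxE /= mulr0.
have GG1 : nrm (1 - G * G) <= 1 by exact: nrm_sub_sqr.
have fV : fixed_mx (cabsv G) by apply: fixed_mx_csqrt => //; exact: fixed_mxM.
have sqr2 Z i j : (forall i j, (Z i j).2 = 0) -> ((Z * Z) i j).2 = 0.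
  move=> Z2; rewrite -mulmxE mxE snd_sum big1 // => k _ /=.
  by rewrite Z2 mul0r.
have V2 : forall i j, (cabsv G i j).2 = 0.
  apply: snd_sqr_eq0; first exact: cabsv_star.
  by move=> i j; rewrite cabsv_sqr //; exact: sqr2.
have fm : fixed_mx (cneg G).
  exact: fixed_mxD fV (fixed_mxN fG).
pose m : 'M[A]_n := map_mx (fun x : D => x.1) (cneg G).
have mE : cneg G = minj m.
  apply/matrixP => i j; rewrite [RHS]mxE [m i j]mxE -uinjP //.
  by rewrite /cneg mxE [(- G) i j]mxE /= V2 G2 subr0.
have sm : star (cneg G) = cneg G by exact: cneg_star.
(* By the bimodule property this entry is [E] of a diagonal entry of a Gram matrix, that is, of a
   sum of positive elements; positivity of [E] on [A] suffices. *)
have p1 k : pos ((cneg G * F * cneg G) k k).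
  rewrite -{1}sm mE -minj_star -!minjM mxcmulE_fixed; last first.
    by move=> i j; have := fm i j; rewrite mE !mxE.
  have -> : mxcmul (mxcmul (mxcstar m) X) m =
            mxcmul (mxcstar (mxcmul Y0 m)) (mxcmul Y0 m).
    have inj : injective (@minj R A n).
      by move=> Z W /matrixP ZW; apply/matrixP => i j; apply: uinj_inj;
         have := ZW i j; rewrite !mxE.
    by apply: inj; rewrite XY !minjM !minj_star !minjM starM !mulrA.
  rewrite !mxE; apply/cposP/Epos; apply: cpos_sum => l _; rewrite !mxE.
  exact: cpos_starM.
pose q := cnegq G.
have sq : star q = q by exact: cnegq_star.
have qq k : (q * q) k k = \sum_l star (q l k) * q l k.
  by rewrite -{1}sq -mulmxE mxE; apply: eq_bigr => l _; rewrite mxE.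
have p2 k : pos (- (q * q) k k).
  have -> : - (q * q) k k = rs t^-1 * (cneg G * F * cneg G) k k.
    have -> : - (q * q) k k = (- (q * q)) k k by rewrite [RHS]mxE.
    have e1 : cneg G * G * cneg G = rs t^-1 * (cneg G * F * cneg G).
      rewrite [X in _ * X * _](_ : G = rs t^-1 * F) //.
      by rewrite [cneg G * (_ * _)]mulrA -rsC -!mulrA.
    by rewrite -cneg_conj // e1 [rs t^-1 * _]mscalE mxE.
  by apply: pos_rs => //; rewrite invr_ge0 ltW.
(* The diagonal of [q * q] is both positive and negative, and its entries are sums of
   [star (q l k) * q l k], so each term vanishes. *)
have q0 : q = 0.
  apply/matrixP => l k; rewrite [RHS]mxE; apply: starM_eq0.
  have ps : pos ((q * q) k k) by rewrite qq; apply: pos_sum => i _; exact: pos_starM.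
  have := pos_antisym ps (p2 k); rewrite qq (bigD1 l) //=.
  apply: pos_eq0_add; first exact: pos_starM.
  by apply: pos_sum => i _; exact: pos_starM.
have GV : G = cabsv G by exact: cneg_eq0.
have V1 : nrm (1 - cabsv G) <= 1 by exact: cabsv_small.
pose S := csqrt (cabsv G).
have SS : S * S = G by rewrite GV; exact: csqrtM.
have sS : star S = S by apply: csqrt_star => //; exact: cabsv_star.
have fS : fixed_mx S by exact: fixed_mx_csqrt.
have S2 : forall i j, (S i j).2 = 0.
  by apply: snd_sqr_eq0 => // i j; rewrite SS.
(* The factor undoes the division of [F] by [t]; nothing is lost in dropping the scalar components
   of [S], which are 0 by [S2]. *)
pose Y : 'M[A]_n := map_mx (fun x : D => (Num.sqrt t)%:C *: x.1) S.
exists Y; split=> [i j|]; first by rewrite mxE linearZ /= fS.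
have YE : minj Y = rs (Num.sqrt t) * S.
  apply/matrixP => i j; rewrite [rs _ * _]mscalE [RHS]mxE [LHS]mxE [Y i j]mxE.
  by rewrite uinjZ -(uinjP (S2 i j)).
have FE : minj (map_mx E X) = minj (mxcmul (mxcstar Y) Y).
  rewrite minjM minj_star YE starM star_rs sS -rsC mulr_rs -[Num.sqrt t * _]expr2.
  by rewrite sqr_sqrtr ?(ltW t0) // SS rsVK.
apply/matrixP => i j; apply: uinj_inj.
by have /matrixP/(_ i j) := FE; rewrite !mxE.
Qed.

End ConditionalExpectation.

(** * Second moments of random words over a partition of unity *)

Section PartitionOfUnity.
Variables (R : realType) (A : cstarAlgType R) (e : A).
Hypotheses (cmul1r : left_id e cmul) (cmulr1 : right_id e cmul).
Variables (I : finType) (f : I -> A).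
Hypothesis f1 : \sum_l f l = e.
Local Notation D := (unitization A).
Implicit Types (u v : I -> R[i]) (s t : R[i]) (a b : A).

(* [multexp K s t] expands, over the words [w] of length [K], the product
   [(s + \sum_m u w_m) (t + \sum_m v w_m)] weighted by [f w_1 * ... * f w_K]:
   these weights are the multinomial probabilities of a random word. *)
Fixpoint multexp u v K s t : A :=
  if K is K'.+1 then \sum_l cmul (f l) (multexp u v K' (s + u l) (t + v l))
  else (s * t) *: e.

(** Among pairs of positions, [K (K - 1)] are distinct and contribute [cmul U V], while [K] coincide
    and contribute the last sum. The induction needs all [s] and [t], which hold the partial sums
    over the letters already read. *)
Lemma multexpE u v (U := \sum_l u l *: f l) (V := \sum_l v l *: f l) K s t :
  cmul U V = cmul V U ->
  multexp u v K s t = (s * t) *: e + (K%:R * s) *: V + (K%:R * t) *: U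
    + (K%:R * (K%:R - 1)) *: cmul U V + K%:R *: \sum_l (u l * v l) *: f l.
Proof.
move=> UV; set Q := \sum_l _ *: f l; elim: K s t => [|K IH] s t.
  by rewrite /= !mul0r !scale0r !addr0.
pose k1 : R[i] := K%:R; pose k2 : R[i] := k1 * (k1 - 1).
pose c0 := (s * t) *: e + (k1 * s) *: V + (k1 * t) *: U + k2 *: cmul U V + k1 *: Q.
pose c1 := t *: e + k1 *: V; pose c2 := s *: e + k1 *: U.
have step l : cmul (f l) (multexp u v K (s + u l) (t + v l)) =
   cmul (f l) c0 + cmul (u l *: f l) c1 + cmul (v l *: f l) c2 + (u l * v l) *: f l.
  (* The identity is checked in the ring [D], where scalars are central elements. *)
  rewrite IH -/k1 -/k2; apply: uinj_inj.
  have -> : (s + u l) * (t + v l) = s * t + u l * t + v l * s + u l * v l by ring.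
  have -> : k1 * (s + u l) = k1 * s + u l * k1 by ring.
  have -> : k1 * (t + v l) = k1 * t + v l * k1 by ring.
  rewrite -[X in _ + (u l * v l) *: X]cmulr1 /c0 /c1 /c2.
  rewrite !(uinjD, uinjM, uinjZ, scalD) ![scal (_ * _)]scalM.
  set x := uinj (f l); set p : D := scal (u l); set q : D := scal (v l).
  have xp : p * x = x * p by exact: scalC.
  have xq : q * x = x * q by exact: scalC.
  have xpq y : p * q * (x * y) = x * p * q * y.
    by rewrite mulrA -[p * q * x]mulrA xq mulrA xp.
  by rewrite xpq xp xq; ncring.
rewrite -[multexp _ _ _ _ _]/(\sum_l cmul (f l) (multexp u v K (s + u l) (t + v l))).
under eq_bigr do rewrite step.
rewrite !big_split /= -!cmul_suml f1 cmul1r -/U -/V -/Q.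
apply: uinj_inj; rewrite /c0 /c1 /c2 -natr1 -/k1.
have -> : (k1 + 1) * (k1 + 1 - 1) = k2 + k1 + k1 by rewrite /k2; ring.
have UVi : uinj U * uinj V = uinj V * uinj U by rewrite -!uinjM UV.
have -> : (k1 + 1) * s = k1 * s + s by ring.
have -> : (k1 + 1) * t = k1 * t + t by ring.
rewrite !(cmulDr, cmulZr, cmulr1) -UV.
rewrite !(uinjD, uinjM, uinjZ, scalD) scal1.
by ncring.
Qed.

Hypothesis fpos : forall l, cpos (f l).
Variable S : set A.
Hypotheses (SM : forall a b, S a -> S b -> S (cmul a b)) (Sf : forall l, S (f l)).
Hypothesis SC : forall a b, S a -> S b -> cmul a b = cmul b a.

(** Here [h] is the product of the weights of the letters already read, positive by commutativity,
    and [x] holds their partial sums. Once the word is read, the matrix is [P h] times a positive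
    scalar matrix of rank at most one. *)
Lemma partition_multexp_pos (C : cstarAlgType R) (P : {linear A -> C}) n
    (c : I -> 'I_n -> R[i]) K : positive_map P ->
  forall (h : A) (x : 'I_n -> R[i]), S h -> cpos h ->
  pos (minj (\matrix_(i, j) P (cmul h (multexp (fun l => Num.conj (c l i))
    (fun l => c l j) K (Num.conj (x i)) (x j))))).
Proof.
move=> Ppos; elim: K => [|K IH] h x Sh ph /=.
  have [b Pb] := Ppos h ph.
  (* All [n] rows of [Z] are equal, so its Gram matrix is [n] times the required one; hence the
     factor [n%:R^-1]. *)
  pose Z : 'M[C]_n := \matrix_(k, j) (x j *: b).
  suff -> : minj (\matrix_(i, j) P (cmul h ((Num.conj (x i) * x j) *: e))) =
      rs n%:R^-1 * (star (minj Z) * minj Z).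
    by apply: pos_rs; [rewrite invr_ge0 ler0n|exact: pos_starM].
  apply/matrixP => i j; have n0 : n%:R != 0 :> R.
    by rewrite pnatr_eq0 -lt0n; case: n i {c x Z j} => // -[].
  rewrite -minj_star -minjM [rs _ * _]mscalE !mxE.
  under eq_bigr do rewrite !mxE cstarZ cmulZl cmulZr scalerA -Pb.
  rewrite sumr_const card_ord cmulZr cmulr1 linearZ /= -[_ *: P h *+ n]scaler_nat !uinjZ.
  rewrite (_ : scal n%:R = rs n%:R); last by rewrite /rs rmorph_nat.
  by rewrite rsK.
have -> : minj (\matrix_(i, j) P (cmul h (\sum_l cmul (f l)
    (multexp (fun l => Num.conj (c l i)) (fun l => c l j) K
      (Num.conj (x i) + Num.conj (c l i)) (x j + c l j))))) =
  \sum_l minj (\matrix_(i, j) P (cmul (cmul h (f l))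
    (multexp (fun l => Num.conj (c l i)) (fun l => c l j) K
      (Num.conj (x i + c l i)) (x j + c l j)))).
  apply/matrixP => i j; rewrite summxE !mxE cmul_sumr linear_sum uinj_sum.
  by apply: eq_bigr => l _; rewrite !mxE cmulA rmorphD.
apply: pos_sum => l _; apply: (IH _ (fun i => x i + c l i)); first exact: SM.
by apply: cpos_cmul => //; exact: SC.
Qed.

(** Words of length [m + 2], starting from zero sums: division by [(m + 2) (m + 1)] leaves the Gram
    term plus [q] over [m + 1], and [pos_archi] removes the latter. *)
Lemma partition_gram_pos (C : cstarAlgType R) (P : {linear A -> C}) n
    (c : I -> 'I_n -> R[i]) (a : 'I_n -> A) : S e -> positive_map P ->
  (forall j, a j = \sum_l c l j *: f l) -> (forall j, S (a j)) ->
  (forall j, S (cstar (a j))) ->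
  pos (minj (\matrix_(i, j) P (cmul (cstar (a i)) (a j)))).
Proof.
move=> Se Ppos aE Sa Ssa.
pose q i j := \sum_l (Num.conj (c l i) * c l j) *: f l.
apply: (@pos_archi _ _ _ (minj (\matrix_(i, j) P (q i j)))) => m.
have pe : cpos e by exact: cpos1.
have := partition_multexp_pos c m.+2 Ppos (fun=> 0) Se pe.
pose t : R := m.+2%:R * m.+1%:R.
have t0 : 0 < t by rewrite mulr_gt0 ?ltr0n.
have ti : 0 <= t^-1 by rewrite invr_ge0 ltW.
move=> /(pos_rs ti); congr pos; apply/matrixP => i j.
rewrite ![rs _ * _]mscalE !mxE cmul1r multexpE; last first.
  have -> : \sum_l Num.conj (c l i) *: f l = cstar (a i).
    rewrite aE cstar_sum; apply: eq_bigr => l _.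
    by rewrite cstarZ (cpos_star (fpos l)).
  by rewrite -aE; exact: SC.
have -> : \sum_l Num.conj (c l i) *: f l = cstar (a i).
  rewrite aE cstar_sum; apply: eq_bigr => l _.
  by rewrite cstarZ (cpos_star (fpos l)).
rewrite -aE -/(q i j) rmorph0 !mulr0 !scale0r !add0r linearD !linearZ /=.
rewrite uinjD !uinjZ mulrDr /rs !mulrA -!scalM -natr1 addrK natr1.
have e1 : (t^-1)%:C * (m.+2%:R * m.+1%:R) = 1 :> R[i].
  by rewrite /t fmorphV rmorphM /= !rmorph_nat mulVf // mulf_neq0 ?pnatr_eq0.
have e2 : (t^-1)%:C * m.+2%:R = (m.+1%:R^-1)%:C :> R[i].
  by rewrite /t !fmorphV rmorphM /= !rmorph_nat invfM mulrAC mulVf ?mul1r ?pnatr_eq0.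
by rewrite e1 e2 scal1 mul1r.
Qed.

End PartitionOfUnity.

(** Scale the real and imaginary parts of each [a j] to contractions [z]. The [4 n] elements [e + z]
    and [e - z] are positive with sum [4 n e], and their differences recover [z]. *)
Lemma partition_span (R : realType) (A : cstarAlgType R) (e : A)
    (S : set A) n (a : 'I_n -> A) :
  left_id e cmul -> right_id e cmul -> (0 < n)%N ->
  (forall x y, S x -> S y -> S (x + y)) -> (forall (k : R[i]) x, S x -> S (k *: x)) ->
  (forall x, S x -> S (cstar x)) -> S e -> (forall j, S (a j)) ->
  exists (I : finType) (f : I -> A) (c : I -> 'I_n -> R[i]),
  [/\ \sum_l f l = e, forall l, cpos (f l), forall l, S (f l)
    & forall j, a j = \sum_l c l j *: f l].
Proof.
move=> e1 e2 n0 SD SZ Ss Se Sa.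
(* Twice the imaginary part of [a j] for [true], twice the real part for [false]. *)
pose s j (b : bool) := if b then 'i%R *: (cstar (a j) - a j) else a j + cstar (a j).
pose t : R := 1 + \sum_j 2 * cn (a j).
have t0 : 0 < t.
  by rewrite ltr_wpDr // sumr_ge0 // => j _; rewrite mulr_ge0 // cn_ge0.
have Ssb j b : S (s j b).
  have SB x y : S x -> S y -> S (x - y).
    by move=> Sx Sy; rewrite -scaleN1r; apply: (SD) => //; exact: SZ.
  by case: b; [apply/SZ/SB|apply: (SD)] => //; exact: Ss.
have ss j b : cstar (s j b) = s j b.
  case: b; last by rewrite /s cstarD cstarK addrC.
  by rewrite /s cstarZ conjCi cstarB cstarK scaleNr -scalerN opprB.
have cns j b : cn (s j b) <= t.
  have h : 2 * cn (a j) <= t.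
    rewrite /t (bigD1 j) //= addrCA lerDl addr_ge0 ?ler01 // sumr_ge0 // => i _.
    by rewrite mulr_ge0 // cn_ge0.
  apply: le_trans h; rewrite mulr_natl mulr2n.
  case: b; rewrite /s ?cnZ ?cabsi ?mul1r (le_trans (cnD _ _)) //.
    by rewrite cn_star cnN.
  by rewrite cn_star.
pose N : R := 4 * n%:R.
have N0 : 0 < N by rewrite mulr_gt0 // ltr0n.
pose z j b : A := (t^-1)%:C *: s j b.
pose f (l : 'I_n * bool * bool) : A :=
  (N^-1)%:C *: (if l.2 then e - z l.1.1 l.1.2 else e + z l.1.1 l.1.2).
(* The weight is such that [w] times the difference [2 z / N] is half of [s], times ['i] for the
   imaginary part. *)
pose w (b : bool) : R[i] := (if b then 'i%R else 1) * (n%:R * t)%:C.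
pose c (l : 'I_n * bool * bool) j : R[i] :=
  if l.1.1 == j then if l.2 then - w l.1.2 else w l.1.2 else 0.
have sum3 (F : 'I_n * bool * bool -> A) :
    \sum_l F l = \sum_j \sum_b (F (j, b, true) + F (j, b, false)).
  rewrite (eq_bigr (fun p => F (p.1.1, p.1.2, p.2))) => [|[[]] //].
  rewrite -(pair_bigA _ (fun p b => F (p.1, p.2, b))) /=.
  rewrite -(pair_bigA _ (fun j b1 => \sum_b F (j, b1, b))) /=.
  by apply: eq_bigr => j _; apply: eq_bigr => b _; rewrite big_bool.
have cz j b : cstar (z j b) = z j b.
  by rewrite cstarZ ss conj_Creal // complex_real.
have zS j b : S (z j b) by exact: SZ.
have cnz j b : cn (z j b) <= 1.
  by rewrite cnZ cabs_real ?invr_ge0 ?(ltW t0) // ler_pdivrMl // mulr1.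
exists ('I_n * bool * bool)%type, f, c; split.
- rewrite sum3 /f /=.
  rewrite (eq_bigr (fun=> (4 * N^-1)%:C *: e)) => [|j _].
    rewrite sumr_const card_ord -[_ *: e *+ n]scaler_nat scalerA.
    rewrite -(rmorph_nat (real_complex R)) -rmorphM /=.
    rewrite (_ : _ * _ = 1) ?scale1r // /N.
    by field; rewrite pnatr_eq0 -lt0n.
  rewrite big_bool /= -!scalerDr rmorphM /= mulrC -scalerA; congr (_ *: _).
  have e4 b : e - z j b + (e + z j b) = 2 *: e.
    by rewrite addrACA addNr addr0 -mulr2n scaler_nat.
  by rewrite !e4 -scalerDl rmorph_nat -natrD.
- move=> [[j b1] b2]; rewrite /f /=; apply: cposZ; first by rewrite invr_ge0 ltW.
  case: b2; first rewrite -[e in e - _]scale1r.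
    exact: (cpos_unitB e1 e2 ler01 (cz j b1) (cnz j b1)).
  rewrite -[z j b1]opprK -[e in e - _]scale1r.
  by apply: (cpos_unitB e1 e2 ler01); rewrite ?cstarN ?cz // cnN.
- move=> [[j b1] b2]; rewrite /f /=; apply: (SZ); case: b2; last exact: SD.
  by rewrite -scaleN1r; exact: SD Se (SZ _ _ (zS j b1)).
move=> j; rewrite sum3 (bigD1 j) //= [X in _ + X]big1 => [|i ij]; last first.
  by rewrite big1 // => b _; rewrite /c /= (negbTE ij) !scale0r addr0.
rewrite addr0 /c /= eqxx /f /=.
have ez b : - w b *: ((N^-1)%:C *: (e - z j b)) + w b *: ((N^-1)%:C *: (e + z j b))
    = (2^-1 * (if b then 'i%R else 1)) *: s j b.
  rewrite scaleNr addrC -!scalerBr opprB [_ + (z j b - e)]addrC addrA subrK.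
  rewrite (_ : z j b + z j b = 2 *: z j b); last by rewrite scaler_nat.
  rewrite /z !scalerA; congr (_ *: _).
  rewrite /w /N rmorphM !fmorphV !rmorphM /= !rmorph_nat; field.
  rewrite !pnatr_eq0 -lt0n n0 /= -(rmorph0 (real_complex R)).
  by rewrite (inj_eq (@complexI R)) lt0r_neq0.
rewrite big_bool !ez /s mulr1 scalerA -mulrA -expr2 sqrCi mulrN1 scaleNr -scalerN opprB.
rewrite /= -scalerDr addrACA addNr addr0 (_ : a j + a j = 2 *: a j); last first.
  by rewrite scaler_nat.
by rewrite scalerA mulVf ?scale1r // pnatr_eq0.
Qed.

(** * From normality to commutativity *)

Section NormalElements.
Variables (R : realType) (A : cstarAlgType R).

(** Normality of [x + cstar y] and of ['i x + cstar y] makes the sum and the difference of the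
    commutators of [y, x] and of [cstar x, cstar y] vanish; adding them gives the claim. *)
Lemma normal_polarization (S : set A) :
  (forall x y, S x -> S y -> S (x + y)) -> (forall (k : R[i]) x, S x -> S (k *: x)) ->
  (forall x, S x -> S (cstar x)) ->
  (forall x, S x -> cmul (cstar x) x = cmul x (cstar x)) ->
  forall x y, S x -> S y -> cmul x y = cmul y x.
Proof.
move=> SD SZ Ss Sn x y Sx Sy.
pose X := uinj x; pose Y := uinj y.
have nD z : S z -> star (uinj z) * uinj z - uinj z * star (uinj z) = 0.
  by move=> /Sn zn; rewrite -uinj_star -!uinjM zn subrr.
have h0 := nD _ Sx; have h1 := nD _ (Ss _ Sy).
have h2 := nD _ (SD _ _ Sx (Ss _ Sy)).
have h3 := nD _ (SD _ _ (SZ 'i%R _ Sx) (Ss _ Sy)).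
rewrite !uinjD !uinj_star uinjZ -/im -/X -/Y in h1 h2 h3.
rewrite -/X in h0; rewrite !starK in h1.
have c1 u v : u * (im * v) = im * (u * v) by rewrite mulrA -imC mulrA.
have h4 : im * (Y * X - X * Y - (star X * star Y - star Y * star X)) = 0.
  rewrite -[RHS]h3 !starD starM star_im starK mulrN -imC.
  transitivity (im * (Y * X - X * Y - (star X * star Y - star Y * star X))
    + (star X * X - X * star X) + (star (star Y) * star Y - star Y * star (star Y))).
    by rewrite h0 starK h1 !addr0.
  rewrite starK !mulrDl !mulrDr !mulNr !mulrN ?c1 -!mulrA ?c1 !mulrA imM; ncring.
have h5 : Y * X - X * Y + (star X * star Y - star Y * star X) = 0.
  rewrite -[RHS]h2 starD starK -[LHS]addr0 -{1}h0 -[LHS]addr0 -h1.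
  by ncring.
have h6 : Y * X - X * Y - (star X * star Y - star Y * star X) = 0.
  by rewrite -[LHS]mul1r -[1]opprK -imM mulNr -mulrA h4 mulr0 oppr0.
apply: uinj_inj; rewrite !uinjM -/X -/Y; apply/eqP; rewrite eq_sym -subr_eq0.
have /eqP : Y * X - X * Y + (Y * X - X * Y) = 0.
  by rewrite -[RHS]h5 -[LHS]subr0 -h6; ncring.
rewrite -mulr2n -mulr_natl -(rs_nat _ 2) => /eqP/(congr1 ( *%R (rs 2^-1))).
by rewrite rsK ?mulr0 ?pnatr_eq0 // => ->.
Qed.

End NormalElements.

(** * The implications for conditional expectations *)

Lemma cond_exp_abelian_breaking (R : realType) (A : cstarAlgType R) (e : A)
    (E : {linear A -> A}) :
  left_id e cmul -> right_id e cmul -> positive_map E -> E e = e ->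
  (forall x, E (E x) = E x) ->
  (forall a x b, E a = a -> E b = b ->
     E (cmul (cmul a x) b) = cmul (cmul a (E x)) b) ->
  (forall a b, E a = a -> E b = b -> cmul a b = cmul b a) ->
  entanglement_breaking E.
Proof.
move=> e1 e2 Epos E1 Eid Ebi Ec C P Ppos n X /(cond_exp_square e1 e2 Epos E1 Eid Ebi).
move=> [Y [fY XY]]; apply: minj_mxcpos.
(* The Gram matrix of [Y] splits into those of its rows, whose entries lie in the abelian range. *)
have -> : minj (map_mx (P \o E) X) =
    \sum_k minj (\matrix_(i, j) P (cmul (cstar (Y k i)) (Y k j))).
  apply/matrixP => i j; rewrite summxE !mxE.
  have /matrixP/(_ i j) := XY; rewrite !mxE /= => ->.
  rewrite linear_sum uinj_sum.
  by apply: eq_bigr => k _; rewrite !mxE.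
apply: pos_sum => k _.
have n0 : (0 < n)%N by exact: leq_ltn_trans (ltn_ord k).
have Es x : E x = x -> E (cstar x) = cstar x.
  by move=> Ex; rewrite (positive_star e1 e2 Epos E1) Ex.
have [|||||I [f [c [f1 fpos Ef aE]]]] :=
  @partition_span R A e [set x | E x = x] n (Y k) e1 e2 n0 => //=.
- by move=> x y Ex Ey; rewrite linearD Ex Ey.
- by move=> t x Ex; rewrite linearZ /= Ex.
apply: (partition_gram_pos e1 e2 f1 fpos (S := [set x | E x = x])) => //=.
- by move=> a b Ea Eb; exact: (fixedM e2 E1 Ebi Ea Eb).
- by move=> j; exact: Es.
Qed.

Lemma cond_exp_ppt_abelian (R : realType) (A : cstarAlgType R) (e : A)
    (E : {linear A -> A}) :
  left_id e cmul -> right_id e cmul -> positive_map E -> E e = e ->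
  (forall a x b, E a = a -> E b = b ->
     E (cmul (cmul a x) b) = cmul (cmul a (E x)) b) ->
  completely_positive (E : A -> opposite A) ->
  forall a b, E a = a -> E b = b -> cmul a b = cmul b a.
Proof.
move=> e1 e2 Epos E1 Ebi cpE.
have Es x : E x = x -> E (cstar x) = cstar x.
  by move=> Ex; rewrite (positive_star e1 e2 Epos E1) Ex.
have EM x y : E x = x -> E y = y -> E (cmul x y) = cmul x y.
  by move=> Ex Ey; exact: (fixedM e2 E1 Ebi Ex Ey).
have le x : E x = x -> cpos (cmul (cstar x) x - cmul x (cstar x)).
  move=> Ex; apply: (cp_op_normal e1 e2 (cstar1 e2) cpE) => //; first exact: Es.
  by apply: EM => //; exact: Es.
apply: (@normal_polarization R A [set x | E x = x]) => /=.
- by move=> x y Ex Ey; rewrite linearD Ex Ey.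
- by move=> t x Ex; rewrite linearZ /= Ex.
- exact: Es.
(* The inequality [le] for [x] and for [cstar x] gives both directions. *)
move=> x Ex; apply/eqP; rewrite -subr_eq0; apply/eqP; apply: cpos_antisym.
  exact: le.
by have := le _ (Es _ Ex); rewrite cstarK opprB.
Qed.

(** * The unit of a von Neumann algebra, and the equivalence *)

Section VonNeumannUnit.
Variables (R : realType) (M : vonNeumannAlgebra R).

(** The norm is the operator norm, so an element acting as 0 has norm 0. The unit laws then follow
    from those of operators. *)
Lemma vn_act_inj : injective (@vn_act R M).
Proof.
move=> a b ab; apply/eqP; rewrite -subr_eq0 -normr_le0.
apply: vn_norm_lub => // x; rewrite mul0r normr_le0.
have := @vn_act_linear R M x (-1) b a; rewrite !scaleN1r [- b + a]addrC => ->.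
by rewrite ab addNr.
Qed.

Lemma vn_mul1r : left_id (vn_one M) cmul.
Proof. by move=> a; apply: vn_act_inj; rewrite vn_actM vn_act1. Qed.

Lemma vn_mulr1 : right_id (vn_one M) cmul.
Proof. by move=> a; apply: vn_act_inj; rewrite vn_actM vn_act1. Qed.

End VonNeumannUnit.

Theorem corollary10p10 (R : realType) (M : vonNeumannAlgebra R)
    (phi : {scalar M}) (E : {linear M -> M}) :
  normal_faithful_state phi ->
  normal_conditional_expectation E ->
  state_preserving phi E ->
  [<-> entanglement_breaking E;
       ppt E;
       abelian_subset (range E)].
Proof.
move=> _ [_ [Epos E1] Eid Ebi _] _.
(* By idempotence the range is the set of fixed points, the form in which the lemmas above are
   stated. *)
have fix_range x : range E x -> E x = x by move=> [y _ <-]; exact: Eid.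
have Ebi' a x b : E a = a -> E b = b ->
    E (cmul (cmul a x) b) = cmul (cmul a (E x)) b.
  by move=> Ea Eb; apply: Ebi; [exists a|exists b].
have e1 := @vn_mul1r R M; have e2 := @vn_mulr1 R M.
tfae.
- exact: entanglement_breaking_ppt.
- move=> [_ cpE] x y /fix_range Ex /fix_range Ey.
  exact: (cond_exp_ppt_abelian e1 e2 Epos E1 Ebi' cpE).
move=> Nab; apply: (cond_exp_abelian_breaking e1 e2 Epos E1 Eid Ebi').
by move=> a b Ea Eb; apply: Nab; [exists a|exists b].
Qed.
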